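(* Assuming a fixed (but arbitrary) alphabet $\Sigma$, there is an $O(|\boldsymbol{t}||\boldsymbol{a}|^2)$ time algorithm to decide whether $L(\boldsymbol{a})\in\mathbb{P}_{\boldsymbol{t},\mathrm{fin}}$, for given transducer $\boldsymbol{t}$ and automaton $\boldsymbol{a}$.
   Context: An automaton is a nondeterministic finite automaton (NFA); $L(\boldsymbol{a})$ is the language accepted by $\boldsymbol{a}$. A (finite) transducer is a tuple $\boldsymbol{t}=(Q,\Sigma,\Gamma,E,I,F)$ where $Q$ is a finite set of states, $I\subseteq Q$ is the nonempty set of initial states, $F\subseteq Q$ is the set of final states, $\Sigma,\Gamma$ are the input and output alphabets, and $E$ is a finite set of transitions. All transducers are assumed to have equal input and output alphabets, $\Sigma=\Gamma$, and to be in standard form: in each transition $(p,x/y,q)\in E$, the input label $x$ is either the empty word $\lambda$ or a symbol of $\Sigma$, and likewise the output label $y$. The label of a path is the pair $(u,v)$, where $u$ (resp. $v$) is the concatenation of the input (resp. output) labels of its transitions. A path is accepting if it starts at an initial state and ends at a final state. For a word $u$, $\boldsymbol{t}(u)$ denotes the set of words $v$ such that $(u,v)$ is the label of some accepting path of $\boldsymbol{t}$. The size $|\boldsymbol{s}|$ of an automaton or transducer $\boldsymbol{s}$ is the sum of the numbers of its states and transitions. For a transducer $\boldsymbol{t}$, the class $\mathbb{P}_{\boldsymbol{t},\mathrm{fin}}$ of languages $L\subseteq\Sigma^*$ is defined by: $L\in\mathbb{P}_{\boldsymbol{t},\mathrm{fin}}$ iff $\boldsymbol{t}(u)\cap L$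 is finite for all $u\in L$. *)

(* Defs.v *)
From mathcomp Require Import all_boot.
From mathcomp Require Import classical_sets cardinality.

Set Implicit Arguments.
Unset Strict Implicit.
Unset Printing Implicit Defensive.

Local Open Scope classical_set_scope.

Record nfa (Sigma : finType) := Nfa {
  nstate : finType;
  ntrans : {set nstate * Sigma * nstate};
  ninit : {set nstate};
  nfinal : {set nstate} }.

(* Standard form: a label [None] is the empty word, [Some c] the symbol [c].  *)
Record transducer (Sigma : finType) := Transducer {
  tstate : finType;
  ttrans : {set tstate * option Sigma * option Sigma * tstate};
  tinit : {set tstate};
  tfinal : {set tstate};
  tinit_neq0 : tinit != finset.set0 }.

Section Languages.
Variable Sigma : finType.
Implicit Types (a : nfa Sigma) (t : transducer Sigma) (u v : seq Sigma).

Fixpoint npath a (p : nstate a) (es : seq (nstate a * Sigma * nstate a))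
    (q : nstate a) : bool :=
  if es is e :: es' then
    [&& e \in ntrans a, e.1.1 == p & npath e.2 es' q]
  else p == q.

Definition language a : set (seq Sigma) :=
  [set u | exists p es q, [/\ p \in ninit a, q \in nfinal a,
     npath p es q & u = [seq e.1.2 | e <- es]]].

Fixpoint tpath t (p : tstate t)
    (es : seq (tstate t * option Sigma * option Sigma * tstate t))
    (q : tstate t) : bool :=
  if es is e :: es' then
    [&& e \in ttrans t, e.1.1.1 == p & tpath e.2 es' q]
  else p == q.

(* [pmap] drops the [None] labels, i.e., it concatenates the labels.          *)
Definition outputs t u : set (seq Sigma) :=
  [set v | exists p es q, [/\ p \in tinit t, q \in tfinal t, tpath p es q,
     u = pmap (fun e => e.1.1.2) es & v = pmap (fun e => e.1.2) es]].

Definition P_fin t (L : set (seq Sigma)) : Prop :=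
  forall u, L u -> finite_set (outputs t u `&` L).

Definition nfa_size a : nat := #|nstate a| + #|ntrans a|.
Definition transducer_size t : nat := #|tstate t| + #|ttrans t|.

End Languages.

(* Algorithms are programs of a unit-cost random access machine, presented as *)
(* while programs: registers and memory cells hold natural numbers, cells are *)
(* addressed by computed numbers, and the only arithmetic operations are      *)
(* addition and truncated subtraction (unit-cost multiplication would allow   *)
(* numbers of exponential length).  Every node of an expression costs 1, and  *)
(* so does every assignment and every evaluation of a test.                   *)

Inductive expr :=
| Cst of nat
| Reg of nat
| Get of expr
| Add of expr & expr
| Monus of expr & expr.

Inductive prog :=
| Skip
| SetReg of nat & expr
| SetMem of expr & expr
| Seq of prog & prog
| If of expr & prog & prog
| While of expr & prog.

Record config := Config { regs : nat -> nat; cells : nat -> nat }.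

Definition upd (f : nat -> nat) (i v : nat) : nat -> nat :=
  fun j => if j == i then v else f j.

Fixpoint eval (s : config) (e : expr) : nat :=
  match e with
  | Cst n => n
  | Reg i => regs s i
  | Get e1 => cells s (eval s e1)
  | Add e1 e2 => eval s e1 + eval s e2
  | Monus e1 e2 => eval s e1 - eval s e2
  end.

Fixpoint cost (e : expr) : nat :=
  match e with
  | Cst _ | Reg _ => 1
  | Get e1 => (cost e1).+1
  | Add e1 e2 | Monus e1 e2 => (cost e1 + cost e2).+1
  end.

(* [exec c s n s']: started in [s], program [c] halts in [s'] after [n] steps;*)
(* this relation is deterministic in [n] and [s'].                            *)
Inductive exec : prog -> config -> nat -> config -> Prop :=
| exec_skip s : exec Skip s 1 s
| exec_setreg s i e :
    exec (SetReg i e) s (cost e).+1 (Config (upd (regs s) i (eval s e)) (cells s))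
| exec_setmem s e1 e2 :
    exec (SetMem e1 e2) s (cost e1 + cost e2).+1
      (Config (regs s) (upd (cells s) (eval s e1) (eval s e2)))
| exec_seq c1 c2 s n1 s1 n2 s2 :
    exec c1 s n1 s1 -> exec c2 s1 n2 s2 -> exec (Seq c1 c2) s (n1 + n2) s2
| exec_if_true e c1 c2 s n s1 :
    eval s e != 0 -> exec c1 s n s1 -> exec (If e c1 c2) s ((cost e).+1 + n) s1
| exec_if_false e c1 c2 s n s1 :
    eval s e = 0 -> exec c2 s n s1 -> exec (If e c1 c2) s ((cost e).+1 + n) s1
| exec_while_true e c s n1 s1 n2 s2 :
    eval s e != 0 -> exec c s n1 s1 -> exec (While e c) s1 n2 s2 ->
    exec (While e c) s ((cost e).+1 + n1 + n2) s2
| exec_while_false e c s :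
    eval s e = 0 -> exec (While e c) s (cost e).+1 s.

(* The input word occupies the first memory cells; everything else is 0.      *)
Definition init_config (x : seq nat) : config := Config (fun=> 0) (nth 0 x).

(* The decision is read off register 0.                                       *)
Definition accepting (s : config) : Prop := regs s 0 != 0.

(* Input format.  The states are numbered, and the transitions, initial and   *)
(* final states listed without repetition, in an arbitrary order: an algorithm*)
(* has to cope with every such presentation.                                  *)

Section Presentations.
Variable Sigma : finType.

Definition sym_code (c : Sigma) : nat := enum_rank c.

Definition lab_code (x : option Sigma) : nat :=
  if x is Some c then (sym_code c).+1 else 0.

Definition nfa_code (a : nfa Sigma) (x : seq nat) : Prop :=
  exists (qs : seq (nstate a)) (es : seq (nstate a * Sigma * nstate a))
         (ini fin : seq (nstate a)),
    [/\ perm_eq qs (enum (nstate a)), perm_eq es (enum (ntrans a)),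
        perm_eq ini (enum (ninit a)), perm_eq fin (enum (nfinal a))
      & x = [:: size qs; size es; size ini; size fin]
            ++ flatten [seq [:: index e.1.1 qs; sym_code e.1.2; index e.2 qs]
                       | e <- es]
            ++ [seq index q qs | q <- ini] ++ [seq index q qs | q <- fin]].

Definition transducer_code (t : transducer Sigma) (x : seq nat) : Prop :=
  exists (qs : seq (tstate t))
         (es : seq (tstate t * option Sigma * option Sigma * tstate t))
         (ini fin : seq (tstate t)),
    [/\ perm_eq qs (enum (tstate t)), perm_eq es (enum (ttrans t)),
        perm_eq ini (enum (tinit t)), perm_eq fin (enum (tfinal t))
      & x = [:: size qs; size es; size ini; size fin]
            ++ flatten [seq [:: index e.1.1.1 qs; lab_code e.1.1.2;
                                lab_code e.1.2; index e.2 qs] | e <- es]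
            ++ [seq index q qs | q <- ini] ++ [seq index q qs | q <- fin]].

End Presentations.

(* Main.v *)
(* Let G be the product of the transducer with two copies of the automaton,    *)
(* one reading the input and one reading the output.  Some word u in L(a) has  *)
(* infinitely many outputs in L(a) iff G has a cycle of transitions with empty *)
(* input, one of them with nonempty output, that is reachable from an initial  *)
(* and leads to a final vertex: if an output is longer than (|u| + 1) times    *)
(* the number of vertices, two of its letters are produced from the same       *)
(* vertex at the same position of u, and the path between them can be pumped.  *)
(* G has O(|t||a|^2) vertices and transitions.  Reachability is decided by     *)
(* depth-first search, and the cycle by Kosaraju's algorithm on the transitions*)
(* with empty input: a transition lies on a cycle iff a search of the reversed *)
(* graph, rooted in the order of decreasing finishing times, reaches both its  *)
(* ends in the same round.                                                     *)
Require Import Defs.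
From mathcomp Require Import all_boot.
From mathcomp Require Import zify.
From mathcomp Require Import classical_sets cardinality.

Set Implicit Arguments.
Unset Strict Implicit.
Unset Printing Implicit Defensive.

(** * A language with arrays *)

(** Words over a finite alphabet form a finite set iff their lengths are bounded
    ([finite_set_size]), so the property fails iff one fixed word u in L(a) has arbitrarily long
    outputs in L(a). Pairs of such words are the labels of the paths from start to final vertices in
    the product G ([outputs_lpath]). A long output on a fixed input forces G to return to a vertex
    after writing a letter but reading nothing ([long_pumpable]); conversely, such a cycle can be
    repeated at will without changing u ([pumpable_long]). This gives [P_fin_pumpable].

    For the time bound, an automaton moves by a transition or stays at a state, hence has exactly
    |a| moves, and each transition of t gives at most |a|^2 edges of G. All that remains is linear
    in G: one search forwards from the start vertices, one backwards from the final ones, and the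
    strongly connected components of the edges with empty input ([kosaraju]). A suitable edge is on
    a cycle iff its two ends lie in the same component.

    The algorithm is written in a language with separate arrays and verified in a logic of total
    correctness with step bounds ([main_spec]). Translation to the random access machine costs a
    constant factor ([compile_correct]), and [main_cost_le] bounds the steps by a multiple of
    |t||a|^2; [ram_decides] combines them. Finally [bad_cycle_pumpable] identifies the numbered
    graph seen by the program with G. *)

Inductive hexpr :=
| HC of nat
| HR of nat
| HA of nat * nat & hexpr
| HAdd of hexpr & hexpr
| HSub of hexpr & hexpr.

Inductive hprog :=
| HSkip
| HSet of nat & hexpr
| HPut of nat * nat & hexpr & hexpr
| HSeq of hprog & hprog
| HIf of hexpr & hprog & hprog
| HWhile of hexpr & hprog.

Record hstate := HState { hr : nat -> nat; ha : nat * nat -> nat -> nat }.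

Definition setr (s : hstate) i v :=
  HState (fun j => if j == i then v else hr s j) (ha s).

Definition seta (s : hstate) (d : nat * nat) i v :=
  HState (hr s) (fun d' => if d' == d then upd (ha s d) i v else ha s d').

Fixpoint heval (s : hstate) (e : hexpr) : nat :=
  match e with
  | HC n => n
  | HR i => hr s i
  | HA d e1 => ha s d (heval s e1)
  | HAdd e1 e2 => heval s e1 + heval s e2
  | HSub e1 e2 => heval s e1 - heval s e2
  end.

(* Every command and test has unit cost: the cost of an expression is bounded  *)
(* by a constant of the program, see [compile_correct].                        *)
Inductive hexec : hprog -> hstate -> nat -> hstate -> Prop :=
| hexec_skip s : hexec HSkip s 1 s
| hexec_set s i e : hexec (HSet i e) s 1 (setr s i (heval s e))
| hexec_put s d e1 e2 :
    hexec (HPut d e1 e2) s 1 (seta s d (heval s e1) (heval s e2))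
| hexec_seq c1 c2 s n1 s1 n2 s2 :
    hexec c1 s n1 s1 -> hexec c2 s1 n2 s2 -> hexec (HSeq c1 c2) s (n1 + n2) s2
| hexec_if_true e c1 c2 s n s1 :
    heval s e != 0 -> hexec c1 s n s1 -> hexec (HIf e c1 c2) s n.+1 s1
| hexec_if_false e c1 c2 s n s1 :
    heval s e = 0 -> hexec c2 s n s1 -> hexec (HIf e c1 c2) s n.+1 s1
| hexec_while_true e c s n1 s1 n2 s2 :
    heval s e != 0 -> hexec c s n1 s1 -> hexec (HWhile e c) s1 n2 s2 ->
    hexec (HWhile e c) s (n1 + n2).+1 s2
| hexec_while_false e c s : heval s e = 0 -> hexec (HWhile e c) s 1 s.

(** * Compilation *)

(* The arrays [(a, p)], with [a < 16] and [p < 8], are interleaved with stride *)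
(* 128 from the base address in machine register 0 on, so that they never      *)
(* overlap whatever their lengths.  Register [i] is machine register [i.+1].   *)
Definition times n (e : expr) : expr := iter n (Add e) (Cst 0).

Definition offset (d : nat * nat) : nat := d.1 + 16 * d.2.

Definition addr (d : nat * nat) (e : expr) : expr :=
  Add (Add (Reg 0) (Cst (offset d))) (times 128 e).

Fixpoint cexpr (e : hexpr) : expr :=
  match e with
  | HC n => Cst n
  | HR i => Reg i.+1
  | HA d e1 => Get (addr d (cexpr e1))
  | HAdd e1 e2 => Add (cexpr e1) (cexpr e2)
  | HSub e1 e2 => Monus (cexpr e1) (cexpr e2)
  end.

Fixpoint cprog (c : hprog) : prog :=
  match c with
  | HSkip => Skip
  | HSet i e => SetReg i.+1 (cexpr e)
  | HPut d e1 e2 => SetMem (addr d (cexpr e1)) (cexpr e2)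
  | HSeq c1 c2 => Seq (cprog c1) (cprog c2)
  | HIf e c1 c2 => If (cexpr e) (cprog c1) (cprog c2)
  | HWhile e c1 => While (cexpr e) (cprog c1)
  end.

Definition wfid (d : nat * nat) := (d.1 < 16) && (d.2 < 8).

Fixpoint wfexpr (e : hexpr) : bool :=
  match e with
  | HC _ | HR _ => true
  | HA d e1 => wfid d && wfexpr e1
  | HAdd e1 e2 | HSub e1 e2 => wfexpr e1 && wfexpr e2
  end.

Fixpoint wfprog (c : hprog) : bool :=
  match c with
  | HSkip => true
  | HSet _ e => wfexpr e
  | HPut d e1 e2 => [&& wfid d, wfexpr e1 & wfexpr e2]
  | HSeq c1 c2 => wfprog c1 && wfprog c2
  | HIf e c1 c2 => [&& wfexpr e, wfprog c1 & wfprog c2]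
  | HWhile e c1 => wfexpr e && wfprog c1
  end.

Fixpoint pcost (c : prog) : nat :=
  match c with
  | Skip => 1
  | SetReg _ e => (cost e).+1
  | SetMem e1 e2 => (cost e1 + cost e2).+1
  | Seq c1 c2 => maxn (pcost c1) (pcost c2)
  | If e c1 c2 => maxn (cost e).+1 (maxn (pcost c1) (pcost c2))
  | While e c1 => maxn (cost e).+1 (pcost c1)
  end.

(** The base address is whatever machine register 0 holds; compiled code never assigns it. Cells
    below the base are unconstrained, which leaves room for the input. *)
Definition sim (hs : hstate) (s : config) : Prop :=
  (forall i, hr hs i = regs s i.+1) /\
  (forall d i, wfid d -> ha hs d i = cells s (regs s 0 + offset d + 128 * i)).

Lemma eval_times s n e : eval s (times n e) = n * eval s e.
Proof. by elim: n => //= n; rewrite mulSn /times /= => ->. Qed.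

Lemma eval_addr s d e : eval s (addr d e) = regs s 0 + offset d + 128 * eval s e.
Proof. by rewrite -eval_times. Qed.

Lemma sim_eval hs s e : sim hs s -> wfexpr e -> eval s (cexpr e) = heval hs e.
Proof.
move=> [Hr Ha]; elim: e => [n|i|d e IH|e1 IH1 e2 IH2|e1 IH1 e2 IH2] //.
- by rewrite /= Hr.
- move=> /andP[wd we]; have IHe := IH we.
  change (cells s (eval s (addr d (cexpr e))) = ha hs d (heval hs e)).
  by rewrite eval_addr Ha // IHe.
- by move=> /andP[/IH1 /= -> /IH2 ->].
- by move=> /andP[/IH1 /= -> /IH2 ->].
Qed.

(** Uniqueness of mixed-radix digits: an address is a + 16 p + 128 i with a < 16 and p < 8. *)
Lemma offset_inj d i d' i' : wfid d -> wfid d' ->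
  offset d + 128 * i = offset d' + 128 * i' -> d = d' /\ i = i'.
Proof.
case: d d' => [a p] [a' p']; rewrite /wfid /offset /= => /andP[? ?] /andP[? ?] E.
have ? : i = i' by lia.
have ? : p = p' by lia.
by split=> //; congr pair; lia.
Qed.

(** Each source step becomes one assignment or test of the machine, and [D] bounds the cost of every
    single one of them. *)
Lemma compile_correct D c hs n hs' s :
  hexec c hs n hs' -> wfprog c -> pcost (cprog c) <= D -> sim hs s ->
  exists n' s', [/\ exec (cprog c) s n' s', n' <= D * n & sim hs' s'].
Proof.
move=> H; elim: H s => {c hs n hs'}.
- by move=> hs s _ D1 S; exists 1, s; split=> //; [constructor|rewrite muln1].
- move=> hs i e s we D1 S.
  eexists _, _; split; [by constructor|by rewrite muln1|].
  case: (S) => Sr Sa; split=> [j|d j wd]; last by rewrite /= Sa.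
  by rewrite /= /upd eqSS; case: eqP => // _; rewrite (sim_eval S we).
- move=> hs d e1 e2 s /and3P[wd we1 we2] D1 S.
  eexists _, _; split; [by constructor|by rewrite muln1|].
  case: (S) => Sr Sa; split=> [j|d' j wd']; first by rewrite /= Sr.
  change ((if d' == d then upd (ha hs d) (heval hs e1) (heval hs e2) else ha hs d') j =
    upd (cells s) (eval s (addr d (cexpr e1))) (eval s (cexpr e2))
     (regs s 0 + offset d' + 128 * j)).
  rewrite eval_addr !(sim_eval S) // /upd.
  case: (d' =P d) => [->|nd].
    rewrite /upd; case: (j =P _) => [->|nj]; first by rewrite eqxx.
    case: eqP => [E|_]; last by rewrite Sa.
    by case: nj; apply: (proj2 (offset_inj wd wd (addnI (etrans (addnA _ _ _) (etrans E (esym (addnA _ _ _))))))).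
  case: eqP => [E|_]; last by rewrite Sa.
  by case: nd; apply: (proj1 (offset_inj wd' wd (addnI (etrans (addnA _ _ _) (etrans E (esym (addnA _ _ _))))))).
- move=> c1 c2 hs n1 hs1 n2 hs2 _ IH1 _ IH2 s /= /andP[w1 w2].
  rewrite geq_max => /andP[D1 D2] S.
  have [m1 [s1 [X1 L1 S1]]] := IH1 _ w1 D1 S.
  have [m2 [s2 [X2 L2 S2]]] := IH2 _ w2 D2 S1.
  exists (m1 + m2), s2; split=> //; first by apply: exec_seq X1 X2.
  by rewrite mulnDr leq_add.
- move=> e c1 c2 hs n hs1 E _ IH s /= /and3P[we w1 w2].
  rewrite !geq_max => /and3P[De D1 D2] S.
  have [m [s1 [X1 L1 S1]]] := IH _ w1 D1 S.
  eexists _, _; split; [apply: exec_if_true X1; by rewrite (sim_eval S)| |exact: S1].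
  by rewrite mulnS leq_add.
- move=> e c1 c2 hs n hs1 E _ IH s /= /and3P[we w1 w2].
  rewrite !geq_max => /and3P[De D1 D2] S.
  have [m [s1 [X1 L1 S1]]] := IH _ w2 D2 S.
  eexists _, _; split; [apply: exec_if_false X1; by rewrite (sim_eval S)| |exact: S1].
  by rewrite mulnS leq_add.
- move=> e c hs n1 hs1 n2 hs2 E _ IH1 _ IH2 s /[dup] W /= /andP[we w1] D0.
  move: (D0); rewrite /= !geq_max => /andP[De D1] S.
  have [m1 [s1 [X1 L1 S1]]] := IH1 _ w1 D1 S.
  have [m2 [s2 [X2 L2 S2]]] := IH2 _ W D0 S1.
  eexists _, _; split; [apply: exec_while_true X1 X2; by rewrite (sim_eval S)| |exact: S2].
  by rewrite mulnS mulnDr addnA !leq_add.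
- move=> e c hs E s /= /andP[we w1]; rewrite geq_max => /andP[De D1] S.
  eexists _, _; split; [apply: exec_while_false; by rewrite (sim_eval S)| |exact: S].
  by rewrite muln1.
Qed.

(** * Total correctness with a cost bound *)

Definition T (c : hprog) (s : hstate) (B : nat) (Q : hstate -> Prop) : Prop :=
  exists n s', [/\ hexec c s n s', n <= B & Q s'].

Fixpoint modr (c : hprog) (i : nat) : bool :=
  match c with
  | HSkip | HPut _ _ _ => false
  | HSet j _ => i == j
  | HSeq c1 c2 | HIf _ c1 c2 => modr c1 i || modr c2 i
  | HWhile _ c1 => modr c1 i
  end.

Fixpoint moda (c : hprog) (d : nat * nat) : bool :=
  match c with
  | HSkip | HSet _ _ => false
  | HPut d' _ _ => d == d'
  | HSeq c1 c2 | HIf _ c1 c2 => moda c1 d || moda c2 d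
  | HWhile _ c1 => moda c1 d
  end.

Definition frame (c : hprog) (s s' : hstate) : Prop :=
  (forall i, modr c i = false -> hr s' i = hr s i) /\
  (forall d, moda c d = false -> ha s' d = ha s d).

Lemma frame_refl c s : frame c s s.
Proof. by []. Qed.

Lemma frame_trans c s s1 s2 : frame c s s1 -> frame c s1 s2 -> frame c s s2.
Proof.
by move=> [R1 A1] [R2 A2]; split=> [i m|d m]; [rewrite R2 // R1|rewrite A2 // A1].
Qed.

Lemma hexec_frame c s n s' : hexec c s n s' -> frame c s s'.
Proof.
elim=> {c s n s'} //.
- by move=> s i e; split=> //= j ->.
- by move=> s d e1 e2; split=> //= d' ->.
- move=> c1 c2 s n1 s1 n2 s2 _ [R1 A1] _ [R2 A2].
  split=> /= [i|d] /negbT; rewrite negb_or => /andP[/negbTE m1 /negbTE m2].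
    by rewrite R2 // R1.
  by rewrite A2 // A1.
- move=> e c1 c2 s n s1 _ _ [R1 A1].
  split=> /= [i|d] /negbT; rewrite negb_or => /andP[/negbTE m1 /negbTE m2].
    by rewrite R1.
  by rewrite A1.
- move=> e c1 c2 s n s1 _ _ [R1 A1].
  split=> /= [i|d] /negbT; rewrite negb_or => /andP[/negbTE m1 /negbTE m2].
    by rewrite R1.
  by rewrite A1.
- by move=> e c s n1 s1 n2 s2 _ _ F1 _ F2; apply: frame_trans F1 F2.
Qed.

(** Whatever a program does not assign syntactically is unchanged, so specifications need to mention
    only what is computed. *)
Lemma T_frame c s B Q :
  T c s B (fun s' => frame c s s' -> Q s') -> T c s B Q.
Proof.
by move=> [n [s' [X L q]]]; exists n, s'; split=> //; apply: q (hexec_frame X).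
Qed.

Lemma T_weaken c s B B' (Q Q' : hstate -> Prop) :
  T c s B Q -> B <= B' -> (forall s', frame c s s' -> Q s' -> Q' s') -> T c s B' Q'.
Proof.
move=> [n [s' [X L q]]] BB H; exists n, s'; split=> //; first exact: leq_trans BB.
by apply: H => //; apply: hexec_frame X.
Qed.

Lemma T_leq c s B B' Q : T c s B Q -> B <= B' -> T c s B' Q.
Proof. by move=> /T_weaken H BB; apply: H. Qed.

Lemma T_skip s B (Q : hstate -> Prop) : Q s -> T HSkip s B.+1 Q.
Proof. by move=> q; exists 1, s; split=> //; constructor. Qed.

Lemma T_set s B i e (Q : hstate -> Prop) :
  Q (setr s i (heval s e)) -> T (HSet i e) s B.+1 Q.
Proof. by move=> q; eexists 1, _; split; [constructor| |exact: q]. Qed.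

Lemma T_put s B d e1 e2 (Q : hstate -> Prop) :
  Q (seta s d (heval s e1) (heval s e2)) -> T (HPut d e1 e2) s B.+1 Q.
Proof. by move=> q; eexists 1, _; split; [constructor| |exact: q]. Qed.

Lemma T_seq c1 c2 s B1 B2 Q :
  T c1 s B1 (fun s1 => T c2 s1 B2 Q) -> T (HSeq c1 c2) s (B1 + B2) Q.
Proof.
move=> [n1 [s1 [X1 L1 [n2 [s2 [X2 L2 q]]]]]].
by exists (n1 + n2), s2; split=> //; [apply: hexec_seq X1 X2|apply: leq_add].
Qed.

Lemma T_set_seq s B i e c Q :
  T c (setr s i (heval s e)) B Q -> T (HSeq (HSet i e) c) s B.+1 Q.
Proof. by move=> H; apply: (@T_seq _ _ _ 1 B); apply: T_set. Qed.

Lemma T_put_seq s B d e1 e2 c Q :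
  T c (seta s d (heval s e1) (heval s e2)) B Q -> T (HSeq (HPut d e1 e2) c) s B.+1 Q.
Proof. by move=> H; apply: (@T_seq _ _ _ 1 B); apply: T_put. Qed.

Lemma T_if e c1 c2 s B Q :
  (heval s e != 0 -> T c1 s B Q) -> (heval s e = 0 -> T c2 s B Q) ->
  T (HIf e c1 c2) s B.+1 Q.
Proof.
move=> H1 H2; case: (boolP (heval s e == 0)) => [/eqP E|E].
  have [n [s' [X L q]]] := H2 E.
  by exists n.+1, s'; split=> //; apply: hexec_if_false.
have [n [s' [X L q]]] := H1 E.
by exists n.+1, s'; split=> //; apply: hexec_if_true.
Qed.

(** The index of [Inv] decreases strictly, hence bounds the number of iterations. An iteration costs
    its body and a test; the outer successor pays for the last, failing test. *)
Lemma T_while (Inv : nat -> hstate -> Prop) m B e c s Q :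
  Inv m s ->
  (forall m1 s1, frame c s s1 -> Inv m1 s1 -> heval s1 e != 0 ->
     T c s1 B (fun s2 => exists2 m2, m2 < m1 & Inv m2 s2)) ->
  (forall m1 s1, frame c s s1 -> Inv m1 s1 -> heval s1 e = 0 -> Q s1) ->
  T (HWhile e c) s (m * B.+1).+1 Q.
Proof.
move=> I0 Hb Hq; move: I0 (frame_refl c s); move: {1 3 4}s => s1 I1 F1.
elim/ltn_ind: m s1 I1 F1 => m IH s1 I1 F1.
case: (boolP (heval s1 e == 0)) => [/eqP E|E].
  by exists 1, s1; split=> //; [apply: hexec_while_false|apply: Hq F1 I1 E].
have [n [s2 [X L [m2 Lm I2]]]] := Hb _ _ F1 I1 E.
have F2 : frame c s s2 by apply: frame_trans F1 (hexec_frame X).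
have [n' [s3 [X' L' q]]] := IH _ Lm s2 I2 F2.
exists (n + n').+1, s3; split=> //; first exact: hexec_while_true E X X'.
have : m2.+1 * B.+1 <= m * B.+1 by rewrite leq_mul2r Lm orbT.
by lia.
Qed.

Definition HFor i n c :=
  HSeq (HSet i (HC 0)) (HWhile (HSub (HR n) (HR i))
    (HSeq c (HSet i (HAdd (HR i) (HC 1))))).

(** The invariant is stated after the counter has been updated. Each iteration pays 2 for test and
    increment, and the final 2 pays for the initialisation and the failing test. *)
Lemma T_for (I : nat -> hstate -> Prop) i n c s B m Q :
  hr s n = m -> modr c i = false -> modr c n = false -> n != i ->
  I 0 (setr s i 0) ->
  (forall j s1, frame (HFor i n c) s s1 -> I j s1 -> j < m -> hr s1 i = j ->
     T c s1 B (fun s2 => I j.+1 (setr s2 i j.+1))) ->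
  (forall s1, frame (HFor i n c) s s1 -> I m s1 -> Q s1) ->
  T (HFor i n c) s (m * (B + 2) + 2) Q.
Proof.
move=> Em mi mn ni I0 Hb Hq.
set c' := HSeq c (HSet i (HAdd (HR i) (HC 1))).
have ni' : modr c' n = false by rewrite /= mn (negbTE ni).
have Fr s1 : frame c' (setr s i 0) s1 -> frame (HFor i n c) s s1.
  move=> [F1 F2]; split=> /= [j|d H]; last by rewrite F2.
  move=> Hj; rewrite F1 /=; last by move/negbT: Hj; rewrite !negb_or => /andP[_ /andP[/negbTE-> /negbTE->]].
  by move/negbT: Hj; rewrite negb_or => /andP[/negbTE->].
apply: T_leq; first apply: T_set_seq.
  apply: (@T_while (fun k s1 => [/\ hr s1 i <= m, I (hr s1 i) s1 & k = m - hr s1 i])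
            m B.+1).
  - by rewrite /= eqxx subn0.
  - move=> k s1 F [Li Is1 ->] /= E.
    have En : hr s1 n = m by rewrite (proj1 F) //= (negbTE ni).
    rewrite En in E.
    have Lt : hr s1 i < m by lia.
    rewrite -[B.+1]addn1 /c'; apply: (@T_seq _ _ _ B 1).
    apply: T_weaken (Hb _ _ (Fr _ F) Is1 Lt erefl) (leqnn _) _ => s2 F2 I2.
    have Ei : hr s2 i = hr s1 i by rewrite (proj1 F2).
    apply: T_set; rewrite /= Ei addn1; exists (m - (hr s1 i).+1); first by lia.
    by rewrite /= eqxx; split.
  - move=> k s1 F [Li Is1 _] /= E.
    have En : hr s1 n = m by rewrite (proj1 F) //= (negbTE ni).
    by apply: Hq; [apply: Fr|have <- : hr s1 i = m by lia].
by lia.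
Qed.

(** * Reachability in directed graphs *)

Inductive reach (A : Type) (G : A -> A -> Prop) (u : A) : A -> Prop :=
| reach_refl : reach G u u
| reach_step v w : reach G u v -> G v w -> reach G u w.

Section Reach.
Variables (A : Type).
Implicit Types (G : A -> A -> Prop).

Lemma reach_trans G u v w : reach G u v -> reach G v w -> reach G u w.
Proof. by move=> H; elim=> // x y _ IH E; apply: reach_step IH E. Qed.

Lemma reach1 G u v : G u v -> reach G u v.
Proof. by apply: reach_step; apply: reach_refl. Qed.

Lemma reach_rev G u v : reach G u v -> reach (fun x y => G y x) v u.
Proof.
elim=> [|x y _ IH E]; first exact: reach_refl.
by apply: reach_trans IH; apply: reach1.
Qed.

Lemma reach_mono G G' u v :
  (forall x y, G x y -> G' x y) -> reach G u v -> reach G' u v.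
Proof. by move=> S; elim=> [|x y _ IH E]; [exact: reach_refl|apply: reach_step IH (S _ _ E)]. Qed.

End Reach.

Lemma nth_in (s : seq nat) i : i < size s -> nth 0 s i \in s.
Proof. exact: mem_nth. Qed.

Lemma index_in (s : seq nat) x : x \in s -> index x s < size s /\ nth 0 s (index x s) = x.
Proof. by move=> xs; rewrite nth_index //; split=> //; rewrite -index_mem in xs. Qed.

(** * Depth-first search with finishing order and round labels *)

(* Round [i] searches from the [i]-th root and marks what it discovers with    *)
(* [i.+1]; the rounds go from the last root down to the first.  The list [od]  *)
(* is in the order of finishing times.  [dfs_post]: if an edge from [u] leads  *)
(* to a [v] finishing after [u], then [v] is on the stack while [u] and any    *)
(* later [z] finish.                                                           *)
Record dfs_result (G : nat -> nat -> Prop) (rts : seq nat) (mk : nat -> nat)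
    (od : seq nat) : Prop := DfsResult {
  dfs_closed : forall u v, G u v -> mk u != 0 -> mk u <= mk v;
  dfs_roots : forall i, i < size rts -> i < mk (nth 0 rts i);
  dfs_labels : forall v, mk v != 0 -> mk v <= size rts /\
    reach (fun x y => G x y /\ mk y = mk v) (nth 0 rts (mk v).-1) v;
  dfs_uniq : uniq od;
  dfs_order : forall v, (v \in od) = (mk v != 0);
  dfs_post : forall u v z, G u v -> u \in od -> z \in od ->
    index u od <= index z od <= index v od -> reach G v z }.

Lemma dfs_result_ext G G' rts mk od : (forall u v, G u v <-> G' u v) ->
  dfs_result G rts mk od -> dfs_result G' rts mk od.
Proof.
move=> E [R1 R2 R3 R4 R5 R6]; split=> //.
- by move=> u v /E; apply: R1.
- move=> v /R3[? R]; split=> //; apply: reach_mono R => x y [/E ? ?]; by split.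
- by move=> u v z /E Guv ? ? ?; apply: reach_mono (R6 _ _ _ Guv _ _ _) => // x y /E.
Qed.

Lemma dfs_marked G rts mk od : dfs_result G rts mk od ->
  forall v, (mk v != 0) <-> exists2 r, r \in rts & reach G r v.
Proof.
move=> D v; split=> [m|[r rr R]].
  have [L R] := dfs_labels D m.
  exists (nth 0 rts (mk v).-1); first by apply: nth_in; lia.
  by apply: reach_mono R => x y [].
elim: R => [|x y _ IH E]; last by have := dfs_closed D E IH; lia.
by have [L1 E1] := index_in rr; have := dfs_roots D L1; rewrite E1; lia.
Qed.

Lemma dfs_label_mono G rts mk od u v : dfs_result G rts mk od ->
  mk u != 0 -> reach G u v -> mk u <= mk v.
Proof.
move=> D m; elim=> // x y _ IH E.
have mx : mk x != 0 by lia.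
by have := dfs_closed D E mx; lia.
Qed.

(* The hypothesis on the path cannot be dropped: with edges g -> w, w -> g and *)
(* g -> x, searched from g, w may finish before x and reach x although x does  *)
(* not reach w.                                                                *)
Lemma dfs_post_reach G rts mk od r : dfs_result G rts mk od -> r \in od ->
  forall u, reach (fun x y => G y x /\ y \in od /\ index y od <= index r od) r u ->
  reach G r u.
Proof.
move=> D rin u R.
have uin : u \in od by elim: R => // x y _ _ [_ []].
(* The induction needs more than u itself: r reaches everything that finishes between u and r. When
   the path is extended by an edge from y to x, a z finishing before x is reached from x by
   [dfs_post], and any other z falls under the induction hypothesis. *)
suff H z : z \in od -> index u od <= index z od <= index r od -> reach G r z.
  apply: H => //; rewrite leqnn /=.
  by elim: R {uin} => // x y _ _ [_ []].
elim: R {uin} z => [|x y R IH [E [yin Ly]]] z zin.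
  move=> L; have Ez : index z od = index r od by lia.
  by rewrite -(nth_index 0 zin) Ez nth_index //; apply: reach_refl.
move=> Lz; have xin : x \in od by elim: R {IH E} => // x1 y1 _ _ [_ []].
case: (leqP (index x od) (index z od)) => Lx; first by apply: IH => //; lia.
apply: reach_trans (dfs_post D E yin zin _); last by lia.
apply: IH => //; rewrite leqnn /=.
by elim: R {xin Lx E} => // x1 y1 _ _ [_ []].
Qed.

(** Labels never decrease along edges of the reversed graph, so mutually reachable vertices share a
    label. Conversely, a vertex reaches the root of its round by reversing the search path, and
    [dfs_post_reach] leads back from the root. *)
Lemma kosaraju G rts mk od mk' od' :
  dfs_result G rts mk od -> dfs_result (fun x y => G y x) od mk' od' ->
  (forall u v, G u v -> u \in od) ->
  forall u v, u \in od -> v \in od ->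
  (mk' u = mk' v <-> reach G u v /\ reach G v u).
Proof.
move=> D D' clos u v uin vin; split=> [E|[R1 R2]]; last first.
  have m w : w \in od -> mk' w != 0.
    by move=> win; have [L1 E1] := index_in win; have := dfs_roots D' L1; rewrite E1; lia.
  have := dfs_label_mono D' (m _ vin) (reach_rev R1).
  by have := dfs_label_mono D' (m _ uin) (reach_rev R2); lia.
have H w : w \in od -> mk' w = mk' v -> 
   reach G w (nth 0 od (mk' v).-1) /\ reach G (nth 0 od (mk' v).-1) w.
  move=> win Ew.
  have mw : mk' w != 0.
    by have [L1 E1] := index_in win; have := dfs_roots D' L1; rewrite E1; lia.
  have [L R] := dfs_labels D' mw; rewrite Ew in L R.
  split.
    by apply: reach_mono (reach_rev R) => x y [].
  have lt : (mk' v).-1 < size od by lia.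
  apply: (dfs_post_reach D); first exact: nth_in.
  apply: reach_mono R => x y [Eyx Ey]; split=> //.
  have yin := clos _ _ Eyx; split=> //.
  (* Every y is itself a root, the one of round [index y od], so its label exceeds its index.
     Sharing the label of this round, y cannot finish after the root of the round. *)
  rewrite index_uniq ?(dfs_uniq D) //.
  by have [L1 E1] := index_in yin; have := dfs_roots D' L1; rewrite E1; lia.
have [? ?] := H _ uin E; have [? ?] := H _ vin erefl.
by split; [apply: (@reach_trans _ _ _ (nth 0 od (mk' v).-1))|apply: (@reach_trans _ _ _ (nth 0 od (mk' v).-1))].
Qed.

Section Dfs.
Variables (N : nat) (adj : nat -> seq nat) (dst : nat -> nat) (rts : seq nat).
Hypothesis dst_lt : forall u e, e \in adj u -> dst e < N.
Hypothesis rts_lt : forall r, r \in rts -> r < N.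

Definition edge u v := exists2 e, e \in adj u & dst e = v.

(* [nr] roots are left, [st] is the stack with its top at the end, and [rem u] *)
(* lists the edges from [u] that are still to be scanned.                      *)
Record dfs_inv nr (st od : seq nat) (rem : nat -> seq nat) mk : Prop := DfsInv {
  di_uniq : uniq (st ++ od);
  di_mem : forall v, (v \in st ++ od) = (mk v != 0);
  di_lt : forall v, mk v != 0 -> v < N;
  di_rem : forall v, subseq (rem v) (adj v);
  di_done : forall v e, e \in adj v -> e \in rem v \/ (mk v != 0 /\ mk v <= mk (dst e));
  di_black : forall v, v \in od -> rem v = [::];
  di_nr : nr <= size rts;
  di_label : forall v, mk v != 0 -> nr < mk v <= size rts;
  di_gray : forall v, v \in st -> mk v = nr.+1;
  di_root : forall i, nr <= i < size rts -> i < mk (nth 0 rts i);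
  di_path : forall v, mk v != 0 ->
    reach (fun x y => edge x y /\ mk y = mk v) (nth 0 rts (mk v).-1) v;
  di_stack : forall i j, i <= j < size st -> reach edge (nth 0 st i) (nth 0 st j);
  di_post : forall u v z, edge u v -> u \in od -> z \in od ->
    index u od <= index z od <= index v od -> reach edge v z }.

Definition updr (rem : nat -> seq nat) v l := fun w => if w == v then l else rem w.

Lemma di_init mk : (forall v, mk v = 0) -> dfs_inv (size rts) [::] [::] adj mk.
Proof.
move=> m0; split=> //; try by move=> v; rewrite m0.
- by move=> v e ->; left.
- by move=> i; lia.
- by move=> i j; rewrite ltn0 andbF.
Qed.

Lemma di_skip_root nr od rem mk : dfs_inv nr.+1 [::] od rem mk ->
  mk (nth 0 rts nr) != 0 -> dfs_inv nr [::] od rem mk.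
Proof.
move=> D m; split; try by case: D.
- by case: D; lia.
- by move=> v /(di_label D); lia.
- move=> i H; case: (i =P nr) => [->|ne]; last by apply: (di_root D); lia.
  by have := di_label D m; lia.
Qed.

Lemma reach_upd mk w l v : mk w = 0 -> mk v != 0 ->
  reach (fun x y => edge x y /\ mk y = mk v) (nth 0 rts (mk v).-1) v ->
  reach (fun x y => edge x y /\ upd mk w l y = mk v) (nth 0 rts (mk v).-1) v.
Proof.
move=> m0 mv; apply: reach_mono => x y [E Ey]; split=> //.
by rewrite /upd; case: eqP => // Ew; move: mv; rewrite -Ey Ew m0.
Qed.

Lemma di_push_root nr od rem mk : dfs_inv nr.+1 [::] od rem mk ->
  mk (nth 0 rts nr) = 0 ->
  dfs_inv nr [:: nth 0 rts nr] od rem (upd mk (nth 0 rts nr) nr.+1).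
Proof.
move=> D m; set r := nth 0 rts nr.
have nr_lt : nr < size rts by have := di_nr D.
have rN : r < N by apply/rts_lt/nth_in.
have Er : upd mk r nr.+1 r = nr.+1 by rewrite /upd eqxx.
have Eu v : v <> r -> upd mk r nr.+1 v = mk v by rewrite /upd => /eqP/negbTE->.
split.
- by rewrite /= (di_uniq D) andbT; have := di_mem D r; rewrite /= m => ->.
- move=> v; rewrite inE; case: (v =P r) => [->|nv]; first by rewrite Er.
  by rewrite Eu //; apply: (di_mem D).
- by move=> v; case: (v =P r) => [->//|/Eu->]; apply: (di_lt D).
- exact: di_rem D.
- move=> v e ev; case: (di_done D ev) => [|[m0 L]]; [by left|right].
  have nv : v <> r by move=> Ev; rewrite Ev m in m0.
  rewrite Eu //; split=> //; rewrite Eu // => Ed; move: L m0; rewrite Ed m; lia.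
- exact: di_black D.
- by lia.
- by move=> v; case: (v =P r) => [->|/Eu->]; [rewrite Er|move/(di_label D)]; lia.
- by move=> v; rewrite inE => /eqP->.
- move=> i H; case: (i =P nr) => [->|ni]; first by rewrite Er.
  have L := di_root D (i := i); rewrite Eu; first by apply: L; lia.
  by move=> E; move: L; rewrite E m; lia.
- move=> v; case: (v =P r) => [->|nv]; rewrite ?Er; first by move=> _; apply: reach_refl.
  rewrite Eu // => mv; apply: reach_upd => //; exact: (di_path D).
- move=> i j /= H; have [-> ->] : i = 0 /\ j = 0 by lia.
  exact: reach_refl.
- exact: di_post D.
Qed.

(** The scanned vertex is on the stack and has label [nr.+1], the least label in use, so the edge
    does not decrease labels. *)
Lemma di_skip_edge nr st od rem mk v e l : dfs_inv nr (rcons st v) od rem mk ->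
  rem v = e :: l -> mk (dst e) != 0 ->
  dfs_inv nr (rcons st v) od (updr rem v l) mk.
Proof.
move=> D Er m; split; try by case: D.
- move=> u; rewrite /updr; case: eqP => [->|_]; last exact: (di_rem D).
  by apply: subseq_trans (di_rem D v); rewrite Er subseq_cons.
- move=> u f fu; rewrite /updr; case: (di_done D fu) => [|H]; last by right.
  case: eqP => [->|_]; last by left.
  rewrite Er inE => /orP[/eqP->|]; [right|by left].
  have gv := di_gray D (v := v); rewrite mem_rcons inE eqxx in gv.
  by have := di_label D m; rewrite gv //; lia.
- move=> u uo; rewrite /updr; case: eqP => [Eu|_]; last exact: (di_black D).
  by have := di_black D uo; rewrite Eu Er.
Qed.

Lemma di_push_edge nr st od rem mk v e l : dfs_inv nr (rcons st v) od rem mk ->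
  rem v = e :: l -> mk (dst e) = 0 ->
  dfs_inv nr (rcons (rcons st v) (dst e)) od (updr rem v l) (upd mk (dst e) nr.+1).
Proof.
move=> D Er m; set w := dst e.
have ev : e \in adj v by apply: (mem_subseq (di_rem D v)); rewrite Er inE eqxx.
have vst : v \in rcons st v by rewrite mem_rcons inE eqxx.
have gv := di_gray D vst.
have mv : mk v != 0 by rewrite gv.
have evw : edge v w by exists e.
have wN : w \notin rcons st v ++ od by rewrite (di_mem D) m.
have Ew : upd mk w nr.+1 w = nr.+1 by rewrite /upd eqxx.
have Eu u : u <> w -> upd mk w nr.+1 u = mk u by rewrite /upd => /eqP/negbTE->.
have nr_lt : nr < size rts by have := di_label D mv; lia.
have lab x : mk x <> 0 -> mk x = upd mk w nr.+1 x by move=> mx; rewrite Eu // => E; rewrite E in mx.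
split.
- have P : perm_eq (rcons (rcons st v) w ++ od) (w :: (rcons st v ++ od)).
    by rewrite cat_rcons -cat1s perm_catCA.
  by rewrite (perm_uniq P) /= wN (di_uniq D).
- move=> u; rewrite cat_rcons mem_cat inE orbCA -mem_cat.
  by case: (u =P w) => [->|/[dup] nu /Eu->]; [rewrite Ew|rewrite (di_mem D)].
- by move=> u; case: (u =P w) => [-> _|/Eu->]; [apply: dst_lt ev|apply: (di_lt D)].
- move=> u; rewrite /updr; case: eqP => [->|_]; last exact: (di_rem D).
  by apply: subseq_trans (di_rem D v); rewrite Er subseq_cons.
- move=> u f fu; rewrite /updr; case: (di_done D fu) => [|[m0 L]].
    case: eqP => [->|_]; last by left.
    rewrite Er inE => /orP[/eqP->|]; [right|by left].
    by rewrite -/w Ew -lab ?gv //; lia.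
  right; rewrite -!lab //; lia.
- move=> u uo; rewrite /updr; case: eqP => [Euv|_]; last exact: (di_black D).
  by have := di_black D uo; rewrite Euv Er.
- exact: di_nr D.
- by move=> u; case: (u =P w) => [->|/Eu->]; [rewrite Ew; lia|apply: (di_label D)].
- move=> u; rewrite mem_rcons inE => /orP[/eqP->//|us].
  by rewrite -lab; have := di_gray D us; lia.
- by move=> i H; rewrite -lab; have := di_root D H; lia.
- move=> u; case: (u =P w) => [-> _|nu].
    rewrite Ew /= (_ : nth 0 rts nr = nth 0 rts (mk v).-1); last by rewrite gv.
    apply: (@reach_step _ _ _ v); last by rewrite Ew.
    have := di_path D mv; rewrite -gv; exact: reach_upd.
  rewrite Eu // => mu; apply: reach_upd => //; exact: (di_path D).
- move=> i j; rewrite size_rcons => /andP[ij]; rewrite ltnS leq_eqVlt.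
  have S k : k < size (rcons st v) -> nth 0 (rcons (rcons st v) w) k = nth 0 (rcons st v) k.
    by move=> H; rewrite [LHS]nth_rcons H.
  case/orP => [/eqP Ej|jl]; last by rewrite !S; [apply: (di_stack D); lia|lia|lia].
  rewrite Ej [X in reach _ _ X]nth_rcons ltnn eqxx.
  move: ij; rewrite leq_eqVlt => /orP[/eqP->|ij].
    by rewrite ?Ej nth_rcons ltnn eqxx; apply: reach_refl.
  apply: (@reach_step _ _ _ v); last exact: evw.
  rewrite S; last by rewrite -Ej.
  have Ev : nth 0 (rcons st v) (size st) = v by rewrite nth_rcons ltnn eqxx.
  rewrite -[X in reach _ _ X]Ev.
  by apply: (di_stack D); rewrite Ej size_rcons in ij *; lia.
- exact: di_post D.
Qed.

(** This is where [di_post] gains instances. All edges of a finished vertex have been scanned, so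
    the target of such an edge is marked. Either it finished before v, and the old invariant
    applies, or it is on the stack, and then it reaches the top v. *)
Lemma di_pop nr st od rem mk v : dfs_inv nr (rcons st v) od rem mk ->
  rem v = [::] -> dfs_inv nr st (rcons od v) rem mk.
Proof.
move=> D Er.
have vst : v \in rcons st v by rewrite mem_rcons inE eqxx.
have gv := di_gray D vst.
have P : perm_eq (st ++ rcons od v) (rcons st v ++ od).
  by rewrite cat_rcons perm_cat2l perm_rcons.
have U := di_uniq D; rewrite -(perm_uniq P) in U.
have vo : v \notin od by move: U; rewrite cat_uniq rcons_uniq => /and3P[_ _ /andP[]].
split; try by case: D.
- by move=> u; rewrite (perm_mem P) (di_mem D).
- move=> u; rewrite mem_rcons inE => /orP[/eqP->//|]; exact: (di_black D).
- by move=> u us; apply: (di_gray D); rewrite mem_rcons inE us orbT.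
- move=> i j H; have := di_stack D (i := i) (j := j); rewrite size_rcons !nth_rcons.
  by rewrite (_ : j < size st) 1?(_ : i < size st); [apply; lia|lia|lia].
have top g : g \in rcons st v -> reach edge g v.
  have Ev : nth 0 (rcons st v) (size st) = v by rewrite nth_rcons ltnn eqxx.
  move=> gs; have [L E] := index_in gs; rewrite -E -[X in reach _ _ X]Ev.
  by apply: (di_stack D); rewrite size_rcons in L *; lia.
have ix x : x \in od -> index x (rcons od v) = index x od by move=> xo; rewrite -cats1 index_cat xo.
have ixv : index v (rcons od v) = size od by rewrite -cats1 index_cat (negbTE vo) /= eqxx addn0.
move=> u w z [e eu Ed]; rewrite !mem_rcons !inE => uo zo /andP[L1 L2].
have [] : w \in od \/ (w \notin od /\ w \in rcons st v).
  case: (boolP (w \in od)) => wo; [by left|right; split=> //].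
  have : w \in rcons st v ++ od; last by rewrite mem_cat (negbTE wo) orbF.
  rewrite (di_mem D) -Ed.
  case: (di_done D eu) => [|[]]; last by lia.
  by case/orP: uo => [/eqP->|/(di_black D)->//]; rewrite Er.
- move=> wo; move: (L2) (L1); rewrite (ix w) // => L3.
  have wl : index w od < size od by have [] := index_in wo.
  have zod : z \in od by case/orP: zo => // /eqP Ez; move: L3; rewrite Ez ixv; lia.
  rewrite (ix z) // in L3 * => L4.
  have uod : u \in od by case/orP: uo => // /eqP Eu; move: L4; rewrite Eu ixv; lia.
  rewrite (ix u) // in L4.
  by apply: (di_post D (u := u)) => //; [exists e|rewrite L3 L4].
move=> [wo ws].
case/orP: zo => [/eqP->|zod]; first exact: top.
have zl : index z od < size od by have [] := index_in zod.
move: L1; rewrite (ix z) // => L1.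
have uod : u \in od by case/orP: uo => // /eqP Eu; move: L1; rewrite Eu ixv; lia.
rewrite (ix u) // in L1.
apply: (di_post D (u := u)) => //; first by exists e.
(* A target outside [od] has index [size od], so it counts as finishing after everything in [od] and
   the old invariant covers it. *)
by rewrite L1 (memNindex wo) ltnW.
Qed.

Lemma di_final od rem mk : dfs_inv 0 [::] od rem mk -> dfs_result edge rts mk od.
Proof.
move=> D; split.
- move=> u v [e eu <-] mu.
  case: (di_done D eu) => [|[]//]; rewrite (di_black D) //.
  by have := di_mem D u; rewrite mu.
- by move=> i H; apply: (di_root D).
- by move=> v mv; split; [case/andP: (di_label D mv)|apply: (di_path D)].
- exact: di_uniq D.
- exact: di_mem D.
- exact: di_post D.
Qed.

End Dfs.

(** * The search as a program *)

Local Notation rM := 11.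
Local Notation rNR := 13.
Local Notation rSP := 14.
Local Notation rCNT := 15.
Local Notation rV := 16.
Local Notation rE := 17.
Local Notation rW := 18.

Local Notation "c1 ;; c2" := (HSeq c1 c2) (at level 90, right associativity).

Fixpoint chain (nx : nat -> nat) h (l : seq nat) : Prop :=
  if l is e :: l' then [/\ h = e, e != 0 & chain nx (nx e) l'] else h = 0.

Lemma chain_upd nx h l e x : e \notin l -> chain nx h l -> chain (upd nx e x) h l.
Proof.
elim: l h => //= f l IH h; rewrite inE negb_or => /andP[/negbTE nf nl] [-> f0 C].
by split=> //; rewrite /upd eq_sym nf; apply: IH.
Qed.

(* Arrays of search [p]: (0, p) heads and (1, p) links of the adjacency lists, *)
(* (2, p) stack, (3, p) marks, (4, p) roots, (4, p.+1) vertices in finishing   *)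
(* order.  Edges are numbered from 1 to [rM], 0 ends a list; the heads move as *)
(* the edges are scanned.                                                      *)
Section Phase.
Variables (p a b c : nat).
(** The shift by 5 makes these arrays differ by computation from the work arrays, numbered 0 to 4,
    of every search. *)
Local Notation src := (a.+4.+1, 0).
Local Notation dst := (b.+4.+1, 0).
Local Notation fl := (c.+4.+1, 0).

Definition build : hprog :=
  HSet rE (HR rM);;
  HWhile (HR rE)
   (HIf (HA fl (HR rE))
      (HPut (1, p) (HR rE) (HA (0, p) (HA src (HR rE)));;
       HPut (0, p) (HA src (HR rE)) (HR rE))
      HSkip;;
    HSet rE (HSub (HR rE) (HC 1))).

Definition adjs (s : hstate) (u : nat) : seq nat :=
  [seq e <- iota 1 (hr s rM) | (ha s fl e != 0) && (ha s src e == u)].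

(** Edges are pushed in front of their lists from the last to the first, so each list ends up in
    increasing order, as in the filtered [iota]. *)
Lemma build_spec s Q :
  (forall v, ha s (0, p) v = 0) ->
  (forall s', frame build s s' -> 
     (forall u, chain (ha s' (1, p)) (ha s' (0, p) u) (adjs s u)) -> Q s') ->
  T build s (hr s rM * 6 + 2) Q.
Proof.
move=> H0 HQ; apply: T_frame.
apply: T_leq; first apply: T_set_seq.
  set M := hr s rM.
  apply: (@T_while (fun m s1 => [/\ m <= M, hr s1 rE = m & forall u, 
     chain (ha s1 (1, p)) (ha s1 (0, p) u)
       [seq e <- iota m.+1 (M - m) | (ha s fl e != 0) && (ha s src e == u)]]) M 5).
  - by split=> //= u; rewrite subnn /= H0.
  - move=> m s1 [Fr Fa] [Lm Em C] /= E; rewrite Em in E.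
    case: m E Lm Em C => // m _ Lm Em C.
    have Efl : ha s1 fl = ha s fl by rewrite Fa.
    have Esrc : ha s1 src = ha s src by rewrite Fa.
    have Ei : iota m.+1 (M - m) = m.+1 :: iota m.+2 (M - m.+1).
      by rewrite (_ : M - m = (M - m.+1).+1) //; lia.
    apply: (@T_seq _ _ _ 4 1); apply: T_if => /=; rewrite Em Efl => Fe.
      apply: T_put_seq; apply: T_put.
      apply: T_set; rewrite /= ?xpair_eqE ?eqxx /= Em Esrc.
      exists m; first by [].
      split=> [||u]; [lia|by rewrite subn1|].
      rewrite Ei /= Fe /=; have Nin : m.+1 \notin iota m.+2 (M - m.+1) by rewrite mem_iota ltnn.
      rewrite {2}/upd eq_sym; case: eqP => [Eu|nu].
        split=> //; apply: chain_upd; first by rewrite mem_filter (negbTE Nin) andbF.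
        by rewrite /upd eqxx Eu; apply: C.
      by apply: chain_upd; [rewrite mem_filter (negbTE Nin) andbF|apply: C].
    apply: T_skip; apply: T_set; rewrite /= Em.
    exists m; first by [].
    split=> [||u]; [lia|by rewrite subn1|].
    by rewrite Ei /= Fe /=; apply: C.
  move=> m s1 F [Lm Em C] /= E F2; apply: HQ => // u.
  by have := C u; rewrite -Em E subn0.
by lia.
Qed.

(** A single flat loop performs one action at a time: scan an edge of the top vertex, pop it, or try
    the next root. Its cost can then be read off one potential. *)
Definition step : hprog :=
  HIf (HR rSP)
   (HSet rV (HA (2, p) (HSub (HR rSP) (HC 1)));;
    HSet rE (HA (0, p) (HR rV));;
    HIf (HR rE)
     (HPut (0, p) (HR rV) (HA (1, p) (HR rE));;
      HSet rW (HA dst (HR rE));;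
      HIf (HA (3, p) (HR rW)) HSkip
       (HPut (3, p) (HR rW) (HAdd (HR rNR) (HC 1));;
        HPut (2, p) (HR rSP) (HR rW);;
        HSet rSP (HAdd (HR rSP) (HC 1))))
     (HPut (4, p.+1) (HR rCNT) (HR rV);;
      HSet rCNT (HAdd (HR rCNT) (HC 1));;
      HSet rSP (HSub (HR rSP) (HC 1))))
   (HSet rNR (HSub (HR rNR) (HC 1));;
    HSet rV (HA (4, p) (HR rNR));;
    HIf (HA (3, p) (HR rV)) HSkip
     (HPut (3, p) (HR rV) (HAdd (HR rNR) (HC 1));;
      HPut (2, p) (HC 0) (HR rV);;
      HSet rSP (HC 1))).

Definition search : hprog := HWhile (HAdd (HR rNR) (HR rSP)) step.

Definition listed (f : nat -> nat) (l : seq nat) := forall i, i < size l -> f i = nth 0 l i.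

Lemma listed_rcons f l x : listed f l -> listed (upd f (size l) x) (rcons l x).
Proof.
move=> H i; rewrite size_rcons ltnS leq_eqVlt /upd nth_rcons => /orP[/eqP->|il].
  by rewrite eqxx ltnn ?eqxx.
by rewrite il ltn_eqF // H.
Qed.

Lemma listed_rconsK f l x : listed f (rcons l x) -> listed f l.
Proof.
by move=> H i il; rewrite H ?size_rcons ?nth_rcons ?il // ltnS ltnW.
Qed.

Section Search.
Variables (N : nat) (adj : nat -> seq nat) (d : nat -> nat) (rts : seq nat).
Hypothesis d_lt : forall u e, e \in adj u -> d e < N.
Hypothesis rts_lt : forall r, r \in rts -> r < N.

(** [m] is a potential that drops at every step. An unmarked vertex counts 2 because it will be
    pushed once and popped once; each edge and each root is consumed once. *)
Definition mem_inv m (s : hstate) : Prop := exists st od rem,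
  [/\ dfs_inv N adj d rts (hr s rNR) st od rem (ha s (3, p)),
     forall v, chain (ha s (1, p)) (ha s (0, p) v) (rem v),
     hr s rSP = size st /\ listed (ha s (2, p)) st,
     hr s rCNT = size od /\ listed (ha s (4, p.+1)) od
   & m = hr s rNR + size st + 2 * (N - (size st + size od)) + \sum_(v < N) size (rem v)].

Lemma sum_updr rem v e l : v < N -> rem v = e :: l ->
  \sum_(u < N) size (rem u) = (\sum_(u < N) size (updr rem v l u)).+1.
Proof.
move=> vN Er; rewrite (bigD1 (Ordinal vN)) //= [X in _ = X.+1](bigD1 (Ordinal vN)) //=.
rewrite /updr eqxx Er /= addSn; congr (_ + _).+1.
by apply: eq_bigr => i /negbTE; rewrite -val_eqE /= => ->.
Qed.

Lemma size_marked nr (st od : seq nat) rem mk : dfs_inv N adj d rts nr st od rem mk -> size st + size od <= N.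
Proof.
move=> D; rewrite -size_cat -(size_iota 0 N); apply: uniq_leq_size (di_uniq D) _ => x.
by rewrite (di_mem D) mem_iota add0n => /(di_lt D).
Qed.

(** The five branches match the five transition lemmas of [dfs_inv]; the longest one, discovering a
    vertex along an edge, takes 10 steps. *)
Lemma step_spec m s : mem_inv m s -> heval s (HAdd (HR rNR) (HR rSP)) != 0 ->
  ha s dst = d -> listed (ha s (4, p)) rts ->
  T step s 10 (fun s2 => exists2 m2, m2 < m & mem_inv m2 s2).
Proof.
move=> [st [od [rem [D C [Esp Lst] [Ecnt Lod] ->]]]] /= G Ed Lrt.
have pp : (p == p.+1) = false by lia.
have pp' : (p.+1 == p) = false by lia.
have U := size_marked D.
apply: T_if => /= E; last first.
  have st0 : st = [::] by apply: size0nil; rewrite -Esp.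
  subst st; rewrite E addn0 in G.
  case En : (hr s rNR) G => [//|nr] _; rewrite En in D.
  have nr_lt : nr < size rts by have := di_nr D.
  apply: T_set_seq; apply: T_set_seq; apply: T_if => /=;
    rewrite ?En ?subn1 /= Lrt // => Em.
    apply: T_skip; eexists; last first.
      exists [::], od, rem; rewrite /= ?En ?subn1 /=; split=> //.
      exact: di_skip_root.
    by rewrite /=; lia.
  apply: T_put_seq; apply: T_put_seq; apply: T_set.
  have D' := di_push_root rts_lt D Em.
  have U' := size_marked D'; rewrite /= in U'.
  eexists; last first.
    exists [:: nth 0 rts nr], od, rem; split.
    - by rewrite /= ?xpair_eqE ?eqxx /= ?En ?subn1 /= ?Lrt // addn1.
    - by rewrite /= ?xpair_eqE ?eqxx /=.
    - by rewrite /= ?xpair_eqE ?eqxx /= ?En ?subn1 /= ?Lrt //; split=> // -[|].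
    - by rewrite /= ?xpair_eqE ?eqxx ?pp' /=.
    - by [].
  by rewrite /= ?En ?subn1 /=; lia.
case/lastP: st => [|st v] in D C Esp Lst U E *; first by rewrite Esp in E.
have vst : v \in rcons st v by rewrite mem_rcons inE eqxx.
have mv : ha s (3, p) v != 0 by rewrite (di_gray D vst).
have vN := di_lt D mv.
rewrite size_rcons in Esp U *.
have Ev : ha s (2, p) (hr s rSP - 1) = v.
  by rewrite Esp subn1 /= Lst ?size_rcons // nth_rcons ltnn eqxx.
apply: T_set_seq; apply: T_set_seq; apply: T_if => /=; rewrite Ev => Ee.
  case Er : (rem v) (C v) => [|e l] /=; first by move=> E0; rewrite E0 in Ee.
  move=> [Ehd e0 Cl].
  have ev : e \in adj v by apply: (mem_subseq (di_rem D v)); rewrite Er inE eqxx.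
  have C' w : chain (ha s (1, p)) (upd (ha s (0, p)) v (ha s (1, p) e) w) (updr rem v l w).
    by rewrite /upd /updr; case: eqP.
  have Es := sum_updr vN Er.
  apply: T_put_seq; apply: T_set_seq; apply: T_if;
     rewrite /= ?xpair_eqE ?eqxx /= ?Ev ?Ehd ?Ed => Em.
    apply: T_skip.
    eexists; last first.
      exists (rcons st v), od, (updr rem v l); split.
      - rewrite /= ?xpair_eqE ?eqxx /=; apply: di_skip_edge Er Em; exact: D.
      - by rewrite /= ?xpair_eqE ?eqxx /= ?Ev ?Ehd.
      - by rewrite /= ?xpair_eqE ?eqxx /= size_rcons.
      - by rewrite /= ?xpair_eqE ?eqxx /=.
      - by [].
    by rewrite /= size_rcons Es; move: (\sum_(u < N) _) => S; lia.
  apply: T_put_seq; apply: T_put_seq; apply: T_set.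
  have D' := di_push_edge d_lt D Er Em.
  have U' := size_marked D'; rewrite !size_rcons in U'.
  eexists; last first.
    exists (rcons (rcons st v) (d e)), od, (updr rem v l); split.
    - by rewrite /= ?xpair_eqE ?eqxx /= ?Ev ?Ehd ?Ed addn1.
    - by rewrite /= ?xpair_eqE ?eqxx /= ?Ev ?Ehd.
    - rewrite /= ?xpair_eqE ?eqxx /= !size_rcons addn1 ?Esp ?Ev ?Ehd ?Ed; split=> //.
      by rewrite -(size_rcons st v); apply: listed_rcons.
    - by rewrite /= ?xpair_eqE ?eqxx /=.
    - by [].
  by rewrite /= !size_rcons Es; move: (\sum_(u < N) _) => S; lia.
have Er : rem v = [::].
  by case Er : (rem v) (C v) => [|e l] //= [Ehd e0 _]; rewrite -Ehd Ee in e0.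
apply: T_put_seq; apply: T_set_seq; apply: T_set.
eexists; last first.
  exists st, (rcons od v), rem; split.
  - by rewrite /= ?xpair_eqE ?eqxx /=; apply: di_pop.
  - by rewrite /= ?xpair_eqE ?eqxx /=.
  - rewrite /= ?xpair_eqE ?eqxx /= Esp subn1; split=> //; exact: listed_rconsK Lst.
  - rewrite /= ?xpair_eqE ?eqxx /= size_rcons addn1 Ecnt; split=> //.
    exact: listed_rcons.
  - by [].
by rewrite /= size_rcons; lia.
Qed.

End Search.

Definition phase : hprog := build;; HSet rSP (HC 0);; HSet rCNT (HC 0);; search.

(** Every edge has a single source, so the adjacency lists together are no longer than the list of
    edges. *)
Lemma sum_fibers (P : pred nat) (f : nat -> nat) N (l : seq nat) :
  \sum_(v < N) size [seq e <- l | P e && (f e == v)] <= size l.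
Proof.
elim: l => [|e l IH] /=; first by rewrite big1.
case: (P e) => /=; last by apply: leq_trans IH _.
case: (ltnP (f e) N) => [lt|ge]; last first.
  apply: leq_trans (leqW IH); apply: leq_sum => v _.
  by rewrite ifN //; apply: contraL ge => /eqP->; rewrite -ltnNge.
apply: leq_trans (_ : \sum_(v < N) ((f e == v) + size [seq e <- l | P e && (f e == v)]) <= _).
  by apply: leq_sum => v _; case: ifP.
rewrite big_split /= -[X in _ <= X]add1n leq_add //.
rewrite (bigD1 (Ordinal lt)) //= eqxx big1 // => v /negbTE.
by rewrite -val_eqE /= eq_sym => ->.
Qed.

Definition graph (s : hstate) (u v : nat) : Prop :=
  exists e, [/\ 0 < e <= hr s rM, ha s fl e != 0, ha s src e = u & ha s dst e = v].

Lemma phase_spec N rts s Q :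
  hr s rNR = size rts -> listed (ha s (4, p)) rts ->
  (forall v, ha s (0, p) v = 0) -> (forall v, ha s (3, p) v = 0) ->
  (forall e, 0 < e <= hr s rM -> ha s src e < N /\ ha s dst e < N) ->
  (forall r, r \in rts -> r < N) ->
  (forall s' od, frame phase s s' -> dfs_result (graph s) rts (ha s' (3, p)) od ->
    hr s' rCNT = size od -> listed (ha s' (4, p.+1)) od -> Q s') ->
  T phase s (hr s rM * 17 + N * 22 + size rts * 11 + 5) Q.
Proof.
move=> Enr Lrt H0 H3 Hlt Hr HQ; apply: T_frame.
set adj := adjs s; set M := hr s rM; set d := ha s dst.
have adjP u e : e \in adj u -> [/\ 0 < e <= M, ha s fl e != 0 & ha s src e = u].
  by rewrite mem_filter mem_iota => /andP[/andP[F /eqP S] I]; split=> //; lia.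
have d_lt u e : e \in adj u -> d e < N by move=> /adjP [/Hlt []].
(* Building the lists takes 6 steps per edge; each unit of the initial potential
   [size rts + 2 * N + M] pays for one iteration, of 10 steps and a test. *)
apply: (@T_leq _ _ (M * 6 + 2 + (((size rts + 2 * N + M) * 11).+1).+2)); last by lia.
apply: T_seq; apply: build_spec => // s1 [F1r F1a] C1.
apply: T_set_seq; apply: T_set_seq => /=.
set s2 := setr _ _ _.
have Ea e : ha s2 e = ha s1 e by [].
have pp' : (p.+1 == p) = false by lia.
have pp : (p == p.+1) = false by lia.
apply: (@T_while (fun m s => exists2 m', m' <= m & mem_inv N adj d rts m' s)).
- eexists; last first.
    exists [::], [::], adj; split=> //=.
    rewrite F1r // Enr; apply: di_init => v.
    by rewrite F1a //= !xpair_eqE.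
  rewrite /= F1r // Enr.
  have := sum_fibers (fun e => ha s fl e != 0) (ha s src) N (iota 1 M).
  rewrite size_iota -/adj; move: (\sum_(v < N) _) => S ?; lia.
- move=> m s3 [F3r F3a] [m' L I] E.
  have Ed : ha s3 dst = d by rewrite F3a //= F1a.
  have Lrt3 : listed (ha s3 (4, p)) rts.
    by rewrite F3a /= ?xpair_eqE ?pp //= F1a //= ?xpair_eqE.
  apply: T_weaken (step_spec d_lt Hr I E Ed Lrt3) (leqnn _) _ => s4 _ [m2 L2 I2].
  by exists m2; [lia|exists m2].
move=> m s3 _ [m' _ [st [od [rem [D C [Esp _] [Ecnt Lod] _]]]]] /= E F.
have st0 : st = [::] by apply: size0nil; lia.
have nr0 : hr s3 rNR = 0 by lia.
rewrite st0 nr0 in D.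
apply: (HQ _ od) => //; apply: dfs_result_ext (di_final D) => u v.
split=> [[e /adjP[e1 e2 e3] e4]|[e [e1 e2 e3 e4]]]; first by exists e.
by exists e => //; rewrite mem_filter e2 e3 eqxx mem_iota /= -/M; lia.
Qed.

End Phase.

(** * The decision program *)

(** For loops that append to a stored list: [S l] says that [l] has been produced so far. The
    arbitrary prefix [l0] lets such loops be nested. *)
Lemma T_flatten (X Y : Type) (S : seq Y -> hstate -> Prop) (F : X -> seq Y) x0
    (l : seq X) i n c s B l0 Q :
  (forall l1 s1 v, S l1 s1 -> S l1 (setr s1 i v)) ->
  hr s n = size l -> modr c i = false -> modr c n = false -> n != i ->
  S l0 s ->
  (forall j s1 l1, frame (HFor i n c) s s1 -> S l1 s1 -> j < size l -> hr s1 i = j ->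
     T c s1 B (S (l1 ++ F (nth x0 l j)))) ->
  (forall s1, frame (HFor i n c) s s1 -> S (l0 ++ flatten (map F l)) s1 -> Q s1) ->
  T (HFor i n c) s (size l * (B + 2) + 2) Q.
Proof.
move=> Si En mi mn ni S0 Hb Hq.
apply: (@T_for (fun j => S (l0 ++ flatten (map F (take j l)))) i n) En mi mn ni _ _ _.
- by rewrite take0 cats0; apply: Si.
- move=> j s1 F1 S1 jl Ej; apply: T_weaken (Hb _ _ _ F1 S1 jl Ej) (leqnn _) _ => s2 _ S2.
  by apply: Si; rewrite (take_nth x0 jl) map_rcons flatten_rcons catA.
- by move=> s1 F1; rewrite take_size; apply: Hq.
Qed.

(** * Numbered instances and their product graph *)

Record problem := Problem {
  nt : nat; tes : seq (nat * nat * nat * nat); tini : seq nat; tfin : seq nat;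
  na : nat; aes : seq (nat * nat * nat); aini : seq nat; afin : seq nat }.

Section Main.
Variable pb : problem.
Local Notation nt := (nt pb).
Local Notation tes := (tes pb).
Local Notation tini := (tini pb).
Local Notation tfin := (tfin pb).
Local Notation na := (na pb).
Local Notation aes := (aes pb).
Local Notation aini := (aini pb).
Local Notation afin := (afin pb).

(* The loops labelled 0 let the automaton stay put on an empty label.          *)
Definition amoves : seq (nat * nat * nat) :=
  [seq (i, 0, i) | i <- iota 0 na] ++ [seq (e.1.1, e.1.2.+1, e.2) | e <- aes].

Definition vcode p q r := (p * na + q) * na + r.

Definition pedge (te : nat * nat * nat * nat) (f g : nat * nat * nat) :=
  if (f.1.2 == te.1.1.2) && (g.1.2 == te.1.2) then
    [:: (vcode te.1.1.1 f.1.1 g.1.1, vcode te.2 f.2 g.2, te.1.1.2, te.1.2)]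
  else [::].

Definition pedges : seq (nat * nat * nat * nat) :=
  flatten [seq flatten [seq flatten [seq pedge te f g | g <- amoves] | f <- amoves] | te <- tes].

Definition proots (lt la : seq nat) : seq nat :=
  flatten [seq flatten [seq flatten [seq [:: vcode p q r] | r <- la] | q <- la] | p <- lt].

Definition off_tini := 4 + 4 * size tes.
Definition off_tfin := off_tini + size tini.
Definition off_a := off_tfin + size tfin.
Definition off_aini := off_a + 4 + 3 * size aes.
Definition off_afin := off_aini + size aini.

Record input_ok (inp : nat -> nat) : Prop := InputOk {
  in_nt : inp 0 = nt;
  in_mt : inp 1 = size tes;
  in_it : inp 2 = size tini;
  in_ft : inp 3 = size tfin;
  in_tes : forall i, i < size tes -> let e := nth (0, 0, 0, 0) tes i in
    [/\ inp (4 + 4 * i) = e.1.1.1, inp (5 + 4 * i) = e.1.1.2,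
        inp (6 + 4 * i) = e.1.2 & inp (7 + 4 * i) = e.2];
  in_tini : listed (fun i => inp (off_tini + i)) tini;
  in_tfin : listed (fun i => inp (off_tfin + i)) tfin;
  in_na : inp off_a = na;
  in_ma : inp (off_a + 1) = size aes;
  in_ia : inp (off_a + 2) = size aini;
  in_fa : inp (off_a + 3) = size afin;
  in_aes : forall i, i < size aes -> let e := nth (0, 0, 0) aes i in
    [/\ inp (off_a + 4 + 3 * i) = e.1.1, inp (off_a + 5 + 3 * i) = e.1.2
      & inp (off_a + 6 + 3 * i) = e.2];
  in_aini : listed (fun i => inp (off_aini + i)) aini;
  in_afin : listed (fun i => inp (off_afin + i)) afin }.

Record prob_ok : Prop := ProbOk {
  ok_tes : forall e, e \in tes -> e.1.1.1 < nt /\ e.2 < nt;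
  ok_tini : forall i, i \in tini -> i < nt;
  ok_tfin : forall i, i \in tfin -> i < nt;
  ok_aes : forall e, e \in aes -> e.1.1 < na /\ e.2 < na;
  ok_aini : forall i, i \in aini -> i < na;
  ok_afin : forall i, i \in afin -> i < na }.

Notation inp := (10, 0).
Notation mtab := (11, 0).
Notation asrc := (12, 0).
Notation alab := (13, 0).
Notation adst := (14, 0).
Notation IN e := (HA inp e).
Notation "a +: b" := (HAdd a b) (at level 50, left associativity).

(* Registers: 1-4 and 6-9 the two input headers, 5 and 22-25 offsets of the    *)
(* sections of the input, 10 the number of automaton moves, 12 the number of   *)
(* vertices, 19-21 loop counters, 26-38 scratch.  Arrays: (5, 0) sources,      *)
(* (6, 0) targets, (7, 0) constant 1, (8, 0) empty input and (9, 0) empty      *)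
(* input with nonempty output, for the product edges; [mtab] tabulates the     *)
(* multiples of [na], the machine having no multiplication.                    *)
Definition parse (k : hprog) : hprog :=
  HSet 1 (IN (HC 0));; HSet 2 (IN (HC 1));; HSet 3 (IN (HC 2));; HSet 4 (IN (HC 3));;
  HSet 22 (HC 4 +: HR 2 +: HR 2 +: HR 2 +: HR 2);;
  HSet 23 (HR 22 +: HR 3);;
  HSet 5 (HR 23 +: HR 4);;
  HSet 6 (IN (HR 5));; HSet 7 (IN (HR 5 +: HC 1));; HSet 8 (IN (HR 5 +: HC 2));;
  HSet 9 (IN (HR 5 +: HC 3));;
  HSet 24 (HR 5 +: HC 4 +: HR 7 +: HR 7 +: HR 7);;
  HSet 25 (HR 24 +: HR 8);;
  HSet 10 (HR 6 +: HR 7);; k.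

(** The first loop computes [nt * na] by repeated addition. The table goes up to this index, so it
    serves both multiplications in [vcode], and its last entry is the number of vertices. *)
Definition mulprog : hprog :=
  HSet 26 (HC 0);;
  HFor 19 1 (HSet 26 (HR 26 +: HR 6));;
  HSet 27 (HC 0);;
  HSet 28 (HR 26 +: HC 1);;
  HFor 19 28 (HPut mtab (HR 19) (HR 27);; HSet 27 (HR 27 +: HR 6));;
  HSet 12 (HA mtab (HR 26)).

Definition movprog : hprog :=
  HFor 19 6 (HPut asrc (HR 19) (HR 19);; HPut alab (HR 19) (HC 0);; HPut adst (HR 19) (HR 19));;
  HSet 29 (HR 5 +: HC 4);; HSet 30 (HR 6);;
  HFor 19 7 (
    HPut asrc (HR 30) (IN (HR 29));;
    HPut alab (HR 30) (IN (HR 29 +: HC 1) +: HC 1);;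
    HPut adst (HR 30) (IN (HR 29 +: HC 2));;
    HSet 29 (HR 29 +: HC 3);; HSet 30 (HR 30 +: HC 1)).

Record ctx (s : hstate) : Prop := Ctx {
  c_mt : hr s 2 = size tes;
  c_it : hr s 3 = size tini;
  c_ft : hr s 4 = size tfin;
  c_ia : hr s 8 = size aini;
  c_fa : hr s 9 = size afin;
  c_am : hr s 10 = size amoves;
  c_N : hr s 12 = nt * na * na;
  c_oti : hr s 22 = off_tini;
  c_otf : hr s 23 = off_tfin;
  c_oai : hr s 24 = off_aini;
  c_oaf : hr s 25 = off_afin;
  c_inp : input_ok (ha s inp);
  c_mul : forall i, i <= nt * na -> ha s mtab i = i * na;
  c_mov : forall i, i < size amoves -> let f := nth (0, 0, 0) amoves i in
    [/\ ha s asrc i = f.1.1, ha s alab i = f.1.2 & ha s adst i = f.2] }.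

Lemma ctx_frame c s s' : frame c s s' ->
  all (fun r => ~~ modr c r) [:: 2; 3; 4; 8; 9; 10; 12; 22; 23; 24; 25] ->
  all (fun d => ~~ moda c d) [:: inp; mtab; asrc; alab; adst] -> ctx s -> ctx s'.
Proof.
move=> [Fr Fa] /allP Mr /allP Ma [*].
have Er r : r \in [:: 2; 3; 4; 8; 9; 10; 12; 22; 23; 24; 25] -> hr s' r = hr s r.
  by move=> /Mr/negbTE/Fr.
have Ea d : d \in [:: inp; mtab; asrc; alab; adst] -> ha s' d = ha s d.
  by move=> /Ma/negbTE/Fa.
by split; rewrite ?Er ?Ea.
Qed.

Lemma size_amoves : size amoves = na + size aes.
Proof. by rewrite size_cat !size_map size_iota. Qed.

Lemma mulprog_spec s Q :
  hr s 1 = nt -> hr s 6 = na ->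
  (forall s', frame mulprog s s' -> hr s' 12 = nt * na * na ->
     (forall i, i <= nt * na -> ha s' mtab i = i * na) -> Q s') ->
  T mulprog s (nt * 3 + nt * na * 4 + 12) Q.
Proof.
move=> E1 E6 HQ; apply: T_frame.
apply: (@T_leq _ _ ((nt * (1 + 2) + 2 + (((nt * na).+1 * (2 + 2) + 2 + 1).+2)).+1)); last by lia.
apply: T_set_seq; apply: T_seq => /=.
apply: (@T_for (fun j s1 => hr s1 26 = j * na)) => //=.
  move=> j s1 [Fr Fa] I jl Ej; apply: T_set => /=; rewrite I Fr //= E6 mulSn; lia.
move=> s1 [F1 A1] I1; apply: T_set_seq; apply: T_set_seq => /=.
apply: T_seq; apply: (@T_for (fun j s2 => hr s2 27 = j * na /\
  forall i, i < j -> ha s2 mtab i = i * na)) => //=; first by rewrite I1 addn1.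
  move=> j s2 [Fr Fa] [I2 J2] jl Ej; apply: T_put_seq; apply: T_set => /=.
  rewrite I2 Fr //= F1 //= E6 mulSn addnC; split=> // i il.
  rewrite /= /upd Ej; case: eqP => [->//|ne]; apply: J2; lia.
move=> s2 [F2 A2] [I2 J2]; apply: T_set => /= F; apply: HQ => //=.
by rewrite F2 //= I1 J2.
Qed.

Lemma nth_amoves_l i : i < na -> nth (0, 0, 0) amoves i = (i, 0, i).
Proof. by move=> il; rewrite nth_cat size_map size_iota il (nth_map 0) ?size_iota // nth_iota. Qed.

Lemma nth_amoves_r i : i < size aes -> let e := nth (0, 0, 0) aes i in
  nth (0, 0, 0) amoves (na + i) = (e.1.1, e.1.2.+1, e.2).
Proof.
move=> il /=; rewrite nth_cat size_map size_iota ltnNge leq_addr /= addKn.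
by rewrite (nth_map (0, 0, 0)).
Qed.

Lemma movprog_spec s Q :
  hr s 5 = off_a -> hr s 6 = na -> hr s 7 = size aes -> input_ok (ha s inp) ->
  (forall s', frame movprog s s' -> 
    (forall i, i < size amoves -> let f := nth (0, 0, 0) amoves i in
    [/\ ha s' asrc i = f.1.1, ha s' alab i = f.1.2 & ha s' adst i = f.2]) -> Q s') ->
  T movprog s (na * 5 + size aes * 7 + 6) Q.
Proof.
move=> E5 E6 E7 I HQ; apply: T_frame.
pose J j (s : hstate) := forall i, i < j -> let f := nth (0, 0, 0) amoves i in
    [/\ ha s asrc i = f.1.1, ha s alab i = f.1.2 & ha s adst i = f.2].
apply: (@T_leq _ _ (na * (3 + 2) + 2 + ((size aes * (5 + 2) + 2).+2))); last by lia.
apply: T_seq; apply: (@T_for J) => //=.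
  move=> j s1 [Fr Fa] J1 jl Ej; apply: T_put_seq; apply: T_put_seq; apply: T_put => /=.
  move=> i /=; rewrite ltnS leq_eqVlt /upd Ej => /orP[/eqP->|il].
    by rewrite eqxx nth_amoves_l.
  by rewrite ltn_eqF //; apply: J1.
move=> s1 [F1 A1] J1; apply: T_set_seq; apply: T_set_seq => /=.
apply: (@T_for (fun j s2 => [/\ hr s2 29 = off_a + 4 + 3 * j, hr s2 30 = na + j & J (na + j) s2]))
  => //=.
- by rewrite F1.
- by rewrite !F1 //= E5 E6 !addn0.
- move=> j s2 [Fr Fa] [G1 G2 J2] jl Ej.
  have [X1 X2 X3] := in_aes I jl.
  have Ei : ha s2 inp = ha s inp by rewrite Fa //= A1.
  do 4 apply: T_put_seq || apply: T_set_seq.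
  apply: T_set; rewrite /= G1 G2 Ei; split; [lia|lia|].
  move=> i /=; rewrite addnS ltnS leq_eqVlt /upd => /orP[/eqP->|il].
    rewrite eqxx nth_amoves_r //=; split=> //.
      by rewrite -X2 addn1; congr (ha s inp _).+1; lia.
    by rewrite -X3; congr (ha s inp _); lia.
  by rewrite ltn_eqF //; apply: J2.
move=> s2 _ [_ _ J2] F; apply: HQ => // i; rewrite size_amoves; apply: J2.
Qed.

Definition setup : hprog := parse (mulprog;; movprog).

Lemma setup_spec s Q :
  input_ok (ha s inp) -> (forall s', frame setup s s' -> ctx s' -> Q s') ->
  T setup s (nt * 3 + nt * na * 4 + na * 5 + size aes * 7 + 32) Q.
Proof.
move=> I HQ; apply: T_frame.
apply: (@T_leq _ _ (nt * 3 + nt * na * 4 + 12 + (na * 5 + size aes * 7 + 6)).+4.+4.+4.+2); last by lia.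
have Eo : 4 + size tes + size tes + size tes + size tes = off_tini by rewrite /off_tini; lia.
do 14 apply: T_set_seq; rewrite /= !(in_nt I, in_mt I, in_it I, in_ft I) !Eo.
rewrite !(in_na I, in_ma I, in_ia I, in_fa I).
set s0 := setr _ 10 _.
apply: T_seq; apply: mulprog_spec => // s1 [F1 A1] H12 Hm.
have H5 : off_tini + size tini + size tfin = off_a by [].
apply: movprog_spec; rewrite ?F1 ?A1 // => s2 [F2 A2] Hmv F.
apply: HQ => //; split;
  try (by [exact: Hmv|rewrite ?F2 ?A2 //; first [exact: H12|exact: Hm|rewrite ?F1 ?A1]]).
- by rewrite F2 // F1 //= size_amoves.
- by rewrite F2 // F1 //= /off_aini H5; lia.
- by rewrite F2 // F1 //= /off_afin /off_aini H5; lia.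
Qed.

(** The test adds the truncated differences in both directions; it vanishes iff both labels of the
    transition agree with those of the two moves. *)
Definition pushedge : hprog :=
  HIf (HSub (HA alab (HR 20)) (HR 32) +: HSub (HR 32) (HA alab (HR 20)) +:
       (HSub (HA alab (HR 21)) (HR 33) +: HSub (HR 33) (HA alab (HR 21))))
    HSkip
   (HSet rM (HR rM +: HC 1);;
    HPut (5, 0) (HR rM) (HA mtab (HA mtab (HR 31) +: HA asrc (HR 20)) +: HA asrc (HR 21));;
    HPut (6, 0) (HR rM) (HA mtab (HA mtab (HR 34) +: HA adst (HR 20)) +: HA adst (HR 21));;
    HPut (7, 0) (HR rM) (HC 1);;
    HPut (8, 0) (HR rM) (HSub (HC 1) (HR 32));;
    HPut (9, 0) (HR rM) (HSub (HC 1) (HR 32 +: HSub (HC 1) (HR 33)))).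

Definition edgeprog : hprog :=
  HSet rM (HC 0);;
  HFor 19 2
   (HSet 29 (HC 4 +: HR 19 +: HR 19 +: HR 19 +: HR 19);;
    HSet 31 (IN (HR 29));; HSet 32 (IN (HR 29 +: HC 1));;
    HSet 33 (IN (HR 29 +: HC 2));; HSet 34 (IN (HR 29 +: HC 3));;
    HFor 20 10 (HFor 21 10 pushedge)).

(** Addresses start at 1 because 0 ends a linked list. For labels x and y, 1 - x is nonzero iff x =
    0, and 1 - (x + (1 - y)) is nonzero iff x = 0 and y is not 0. *)
Definition estored (l : seq (nat * nat * nat * nat)) (s : hstate) : Prop :=
  hr s rM = size l /\ forall i, i < size l -> let e := nth (0, 0, 0, 0) l i in
    [/\ ha s (5, 0) i.+1 = e.1.1.1, ha s (6, 0) i.+1 = e.1.1.2, ha s (7, 0) i.+1 = 1,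
        ha s (8, 0) i.+1 = 1 - e.1.2 & ha s (9, 0) i.+1 = 1 - (e.1.2 + (1 - e.2))].

Hypothesis pok : prob_ok.

Lemma amoves_lt f : f \in amoves -> f.1.1 < na /\ f.2 < na.
Proof.
rewrite mem_cat => /orP[] /mapP[e]; first by rewrite mem_iota => ? ->.
by move=> /(ok_aes pok) [? ?] ->.
Qed.

Lemma vrow_le p q : p < nt -> q < na -> p * na + q <= nt * na.
Proof.
move=> Lp Lq; have : p.+1 * na <= nt * na by rewrite leq_mul2r Lp orbT.
by rewrite mulSn; lia.
Qed.

Lemma vcode_lt p q r : p < nt -> q < na -> r < na -> vcode p q r < nt * na * na.
Proof.
move=> Lp Lq Lr; rewrite /vcode.
have L : p * na + q < nt * na.
  have : p.+1 * na <= nt * na by rewrite leq_mul2r Lp orbT.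
  by rewrite mulSn; lia.
have : (p * na + q).+1 * na <= nt * na * na by rewrite leq_mul2r L orbT.
by rewrite mulSn; lia.
Qed.

Lemma c_vcode s p q r : ctx s -> p < nt -> q < na ->
  ha s mtab (ha s mtab p + q) + r = vcode p q r.
Proof.
move=> C Lp Lq; have na0 : 0 < na by lia.
have Lp' : p <= nt * na by apply: leq_trans (ltnW Lp) _; apply: leq_pmulr.
by rewrite !(c_mul C) // vrow_le.
Qed.

Lemma dist0 (a b c d : nat) :
  a - b + (b - a) + (c - d + (d - c)) = 0 -> (a == b) && (c == d).
Proof. by move=> H; apply/andP; split; lia. Qed.

Lemma pushedge_spec s j k te l (f := nth (0, 0, 0) amoves j) (g := nth (0, 0, 0) amoves k) :
  ctx s -> te \in tes -> j < size amoves -> k < size amoves ->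
  hr s 20 = j -> hr s 21 = k ->
  hr s 31 = te.1.1.1 -> hr s 32 = te.1.1.2 -> hr s 33 = te.1.2 -> hr s 34 = te.2 ->
  estored l s -> T pushedge s 7 (estored (l ++ pedge te f g)).
Proof.
move=> C tein jl kl E20 E21 E31 E32 E33 E34 [EM El].
have [fs flab fd] := c_mov C jl; have [gs glab gd] := c_mov C kl.
have [f1 f2] := amoves_lt (mem_nth (0, 0, 0) jl).
rewrite -/f -/g in fs flab fd gs glab gd f1 f2; clearbody f g.
have [t1 t2] := ok_tes pok tein.
rewrite /pedge; apply: T_if => /=; rewrite E20 E21 E32 E33 flab glab => D.
  rewrite ifN ?cats0; first exact: T_skip.
  by apply: contra D => /andP[/eqP-> /eqP->]; rewrite !subnn.
rewrite ifT; last exact: dist0 D.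
do 5 apply: T_set_seq || apply: T_put_seq.
apply: T_put; split=> /=; first by rewrite size_cat EM.
rewrite E20 E21 E31 E32 E33 E34 EM fs fd gs gd !(c_vcode _ C) // addn1.
move=> i; rewrite size_cat addn1 ltnS leq_eqVlt /upd => /orP[/eqP->|il].
  by rewrite !eqxx nth_cat ltnn subnn.
by rewrite eqSS ltn_eqF // nth_cat il; apply: El.
Qed.

Lemma edgeprog_spec s Q : ctx s ->
  (forall s', frame edgeprog s s' -> estored pedges s' -> Q s') ->
  T edgeprog s (size tes * (size amoves * (size amoves * 9 + 4) + 9) + 3) Q.
Proof.
move=> C HQ; apply: T_frame.
rewrite [_ + 3]addnS; apply: T_set_seq => /=.
rewrite (_ : _ + 9 = (size amoves * (size amoves * (7 + 2) + 2 + 2) + 2).+4.+1 + 2); last by lia.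
set s0 := setr _ _ _.
have C0 : ctx s0 by case: C.
apply: (@T_flatten _ _ estored
  (fun te => flatten [seq flatten [seq pedge te f g | g <- amoves] | f <- amoves])
  (0, 0, 0, 0) tes _ _ _ _ _ [::]) => //.
- exact: c_mt C0.
- move=> j s1 l1 F1 S1 jl Ej.
  have C1 := ctx_frame F1 erefl erefl C0.
  set te := nth _ _ _; have tein : te \in tes by apply: mem_nth.
  have [X1 X2 X3 X4] := in_tes (c_inp C1) jl.
  do 5 apply: T_set_seq; rewrite /= !Ej.
  have -> : 4 + j + j + j + j = 4 + 4 * j by lia.
  have -> : 4 + 4 * j + 1 = 5 + 4 * j by lia.
  have -> : 4 + 4 * j + 2 = 6 + 4 * j by lia.
  have -> : 4 + 4 * j + 3 = 7 + 4 * j by lia.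
  rewrite X1 X2 X3 X4 -/te; set s2 := setr _ 34 _.
  have C2 : ctx s2 by case: C1.
  apply: (@T_flatten _ _ estored (fun f => flatten [seq pedge te f g | g <- amoves])
           (0, 0, 0) amoves _ _ _ _ _ l1) => //; first exact: c_am C2.
  move=> j2 s3 l3 F3 S3 j2l Ej2.
  have C3 := ctx_frame F3 erefl erefl C2.
  apply: (@T_flatten _ _ estored (pedge te (nth (0, 0, 0) amoves j2)) (0, 0, 0) amoves _ _ _ _ _ l3) => //; first exact: c_am C3.
  move=> j3 s4 l4 F4 S4 j3l Ej3.
  have C4 := ctx_frame F4 erefl erefl C3.
  case: F4 F3 => F4 _ [F3 _].
  by apply: pushedge_spec => //; rewrite F4 //; first [exact: Ej2|rewrite F3].
- by move=> s1 _ S1 F1; apply: HQ.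
Qed.

Definition rootprog p : hprog :=
  HSet rNR (HC 0);;
  HFor 19 36
   (HSet 29 (HA mtab (IN (HR 35 +: HR 19)));;
    HFor 20 38
     (HSet 30 (HA mtab (HR 29 +: IN (HR 37 +: HR 20)));;
      HFor 21 38
       (HPut (4, p) (HR rNR) (HR 30 +: IN (HR 37 +: HR 21));;
        HSet rNR (HR rNR +: HC 1)))).

Definition rstored p (l : seq nat) (s : hstate) : Prop :=
  hr s rNR = size l /\ listed (ha s (4, p)) l.

Lemma rootprog_spec p s lt la Q : ctx s ->
  hr s 36 = size lt -> hr s 38 = size la ->
  listed (fun i => ha s inp (hr s 35 + i)) lt -> listed (fun i => ha s inp (hr s 37 + i)) la ->
  (forall i, i \in lt -> i < nt) -> (forall i, i \in la -> i < na) ->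
  (forall s', frame (rootprog p) s s' -> rstored p (proots lt la) s' -> Q s') ->
  T (rootprog p) s (size lt * (size la * (size la * 4 + 5) + 5) + 3) Q.
Proof.
move=> C E36 E38 Llt Lla Hlt Hla HQ; apply: T_frame.
rewrite [_ + 3]addnS; apply: T_set_seq => /=.
rewrite (_ : _ + 5 = (size la * ((size la * (2 + 2) + 2).+1 + 2) + 2).+1 + 2); last by lia.
set s0 := setr _ _ _.
have C0 : ctx s0 by case: C.
apply: (@T_flatten _ _ (rstored p)
  (fun p => flatten [seq flatten [seq [:: vcode p q r] | r <- la] | q <- la])
  0 lt _ _ _ _ _ [::]) => //.
- move=> j s1 l1 F1 S1 jl Ej.
  have C1 := ctx_frame F1 erefl erefl C0.
  apply: T_set_seq; rewrite /= Ej.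
  case: (F1) => F1r F1a.
  have -> : ha s1 inp (hr s1 35 + j) = nth 0 lt j by rewrite F1r // F1a //= Llt.
  set x := nth 0 lt j; have xl : x < nt by apply/Hlt/nth_in.
  have Lx : ha s1 mtab x = ha s mtab x by rewrite F1a.
  set s2 := setr _ _ _.
  have C2 : ctx s2 by case: C1.
  apply: (@T_flatten _ _ (rstored p) (fun q => flatten [seq [:: vcode x q r] | r <- la])
           0 la _ _ _ _ _ l1) => //; first by rewrite /= F1r.
  move=> j2 s3 l3 F3 S3 j2l Ej2.
  have C3 := ctx_frame F3 erefl erefl C2.
  case: (F3) => F3r F3a.
  apply: T_set_seq; rewrite /= Ej2.
  have -> : ha s3 inp (hr s3 37 + j2) = nth 0 la j2.
    by rewrite F3r // F3a //= F1r // F1a //= Lla.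
  set y := nth 0 la j2; have yl : y < na by apply/Hla/nth_in.
  set s4 := setr _ _ _.
  have C4 : ctx s4 by case: C3.
  apply: (@T_flatten _ _ (rstored p) (fun r => [:: vcode x y r]) 0 la _ _ _ _ _ l3) => //.
    by rewrite /= F3r //= F1r.
  move=> j3 s5 l5 [F5r F5a] [S5 S5'] j3l Ej3.
  apply: T_put_seq; apply: T_set; split; rewrite /= ?xpair_eqE ?eqxx /= S5.
    by rewrite size_cat.
  have -> : ha s5 inp (hr s5 37 + hr s5 21) = nth 0 la j3.
    by rewrite Ej3 F5r // F5a //= F3r // F3a //= F1r // F1a //= Lla.
  have -> : hr s5 30 = ha s1 mtab (ha s1 mtab x + y).
    by rewrite F5r //= F3r // F3a.
  by rewrite (c_vcode _ C1) // cats1; apply: listed_rcons.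
- by move=> s1 _ S1 F1; apply: HQ.
Qed.

Definition check : hprog :=
  HSet 0 (HC 1);;
  HFor 19 rM
   (HSet rE (HR 19 +: HC 1);;
    HIf (HA (9, 0) (HR rE))
     (HIf (HA (3, 0) (HA (5, 0) (HR rE)))
       (HIf (HA (3, 2) (HA (5, 0) (HR rE)))
         (HIf (HSub (HA (3, 5) (HA (5, 0) (HR rE))) (HA (3, 5) (HA (6, 0) (HR rE))) +:
               HSub (HA (3, 5) (HA (6, 0) (HR rE))) (HA (3, 5) (HA (5, 0) (HR rE))))
           HSkip (HSet 0 (HC 0)))
         HSkip)
       HSkip)
     HSkip).

Lemma check_spec s Q (F B K : nat -> nat) : estored pedges s ->
  ha s (3, 0) = F -> ha s (3, 2) = B -> ha s (3, 5) = K ->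
  (forall s', hr s' 0 = ~~ has (fun e => [&& 1 - (e.1.2 + (1 - e.2)) != 0, F e.1.1.1 != 0,
     B e.1.1.1 != 0 & K e.1.1.1 == K e.1.1.2]) pedges -> Q s') ->
  T check s (size pedges * 8 + 3) Q.
Proof.
move=> [EM El] EF EB EK HQ.
rewrite [_ + 3]addnS; apply: T_set_seq => /=.
set b := fun e => _ in HQ.
apply: (@T_for (fun j s1 => hr s1 0 = ~~ has b (take j pedges)) _ _ _ _ 6) => //=.
- by rewrite take0.
- move=> j s1 [Fr Fa] I jl Ej.
  set e := nth (0, 0, 0, 0) pedges j.
  have [X1 X2 _ _ X3] := El j jl; rewrite -/e in X1 X2 X3.
  rewrite (take_nth (0, 0, 0, 0) jl) -cats1 has_cat /= orbF negb_or -/e.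
  have I0 x : hr s1 0 = ~~ x -> b e = false -> hr s1 0 = ~~ x && ~~ b e :> nat.
    by move=> -> ->; rewrite andbT.
  rewrite /b in I0 I *.
  apply: T_set_seq; rewrite /= Ej addn1.
  apply: T_if; rewrite /= Fa //= X3 => H1; last by apply: T_skip => /=; apply: I0 => //; rewrite H1.
  apply: T_if; rewrite /= !Fa //= X1 EF => H2; last by apply: T_skip => /=; apply: I0 => //; rewrite H2 andbF.
  apply: T_if; rewrite /= !Fa //= X1 EB => H3; last by apply: T_skip => /=; apply: I0 => //; rewrite H3 !andbF.
  apply: T_if; rewrite /= !Fa //= X1 X2 EK => H4.
    apply: T_skip => /=; apply: I0 => //; rewrite (_ : (K _ == _) = false) ?andbF //.
    by apply: contraNF H4 => /eqP->; rewrite subnn.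
  apply: T_set => /=; rewrite H1 H2 H3 /= (_ : (K _ == _) = true) ?andbF //.
  by apply/eqP; lia.
by move=> s1 _; rewrite take_size; apply: HQ.
Qed.

(** Searches 0 and 2 compute what is reachable from the start vertices and what leads to final ones;
    4 and 5 are the two passes for the components. Search 4 leaves its finishing order in array (4,
    5), exactly where search 5 takes its roots. *)
Definition mainprog : hprog :=
  setup;; edgeprog;;
  HSet 35 (HR 22);; HSet 36 (HR 3);; HSet 37 (HR 24);; HSet 38 (HR 8);;
  rootprog 0;; phase 0 0 1 2;;
  HSet 35 (HR 23);; HSet 36 (HR 4);; HSet 37 (HR 25);; HSet 38 (HR 9);;
  rootprog 2;; phase 2 1 0 2;;
  HSet rNR (HR 12);; HFor 19 12 (HPut (4, 4) (HR 19) (HR 19));; phase 4 0 1 3;;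
  HSet rNR (HR rCNT);; phase 5 1 0 3;;
  check.

Lemma estored_frame l c s s' : frame c s s' -> modr c rM = false ->
  all (fun d => ~~ moda c d) [:: (5, 0); (6, 0); (7, 0); (8, 0); (9, 0)] ->
  estored l s -> estored l s'.
Proof.
move=> [Fr Fa] Mr /allP Ma [EM El].
have Ea d : d \in [:: (5, 0); (6, 0); (7, 0); (8, 0); (9, 0)] -> ha s' d = ha s d.
  by move=> /Ma/negbTE/Fa.
by split; [rewrite Fr|rewrite !Ea].
Qed.

Definition gall u v := exists2 e, e \in pedges & e.1.1.1 = u /\ e.1.1.2 = v.
Definition glam u v := exists2 e, e \in pedges & [/\ e.1.1.1 = u, e.1.1.2 = v & e.1.2 = 0].

(** Both accessibility conditions are put on the source of the edge: all vertices of the cycle share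
    them. *)
Definition bad_cycle : Prop := exists2 e, e \in pedges &
  [/\ e.1.2 = 0, e.2 != 0,
      exists2 r, r \in proots tini aini & reach gall r e.1.1.1,
      exists2 r, r \in proots tfin afin & reach gall e.1.1.1 r
    & reach glam e.1.1.2 e.1.1.1].

Lemma pedges_lt e : e \in pedges -> e.1.1.1 < nt * na * na /\ e.1.1.2 < nt * na * na.
Proof.
move=> /flatten_mapP[te /(ok_tes pok)[? ?] /flatten_mapP[f /amoves_lt[? ?] /flatten_mapP[g /amoves_lt[? ?]]]].
by rewrite /pedge; case: ifP => // _; rewrite inE => /eqP->; split; apply: vcode_lt.
Qed.

Lemma proots_lt lt la v : (forall i, i \in lt -> i < nt) -> (forall i, i \in la -> i < na) ->
  v \in proots lt la -> v < nt * na * na.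
Proof.
move=> Ht Ha /flatten_mapP[p /Ht ? /flatten_mapP[q /Ha ? /flatten_mapP[r /Ha ?]]].
by rewrite inE => /eqP->; apply: vcode_lt.
Qed.

Lemma size_flatten_le (X Y : Type) (F : X -> seq Y) l k :
  (forall x, size (F x) <= k) -> size (flatten (map F l)) <= size l * k.
Proof. by move=> H; elim: l => //= x l IH; rewrite size_cat mulSn leq_add. Qed.

Lemma size_pedges : size pedges <= size tes * (size amoves * size amoves).
Proof.
do 2!(apply: size_flatten_le => ?); rewrite -[X in _ <= X]muln1.
by apply: size_flatten_le => g; rewrite /pedge; case: ifP.
Qed.

Lemma size_proots lt la : size (proots lt la) <= size lt * (size la * size la).
Proof.
by do 2!(apply: size_flatten_le => ?); rewrite -[X in _ <= X]muln1; apply: size_flatten_le.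
Qed.

Lemma pedge_nth (P : nat * nat * nat * nat -> Prop) (Q : nat -> Prop) s :
  estored pedges s -> 
  (forall i, i < size pedges -> Q i.+1 <-> P (nth (0, 0, 0, 0) pedges i)) ->
  (exists e, 0 < e <= hr s rM /\ Q e) <-> (exists2 e, e \in pedges & P e).
Proof.
move=> [EM _] H; split=> [[[|i] [//]]|[e ein Pe]]; rewrite ?EM /=.
  move=> il q; exists (nth (0, 0, 0, 0) pedges i); first exact: mem_nth.
  exact/H.
exists (index e pedges).+1; split; first by rewrite index_mem.
by apply/H; rewrite ?index_mem // nth_index.
Qed.

Lemma graph_all s : estored pedges s -> forall u v, graph 0 1 2 s u v <-> gall u v.
Proof.
move=> S u v; rewrite /gall /graph -(pedge_nth (s := s) (Q := fun e =>
   [/\ ha s (7, 0) e != 0, ha s (5, 0) e = u & ha s (6, 0) e = v])) //.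
  by split=> [[e [? ? ? ?]]|[e [? [? ? ?]]]]; exists e; do !split.
by move=> i il; have [-> -> -> _ _] := proj2 S i il; split=> [[]|[]].
Qed.

Lemma graph_lam s : estored pedges s -> forall u v, graph 0 1 3 s u v <-> glam u v.
Proof.
move=> S u v; rewrite /glam /graph -(pedge_nth (s := s) (Q := fun e =>
   [/\ ha s (8, 0) e != 0, ha s (5, 0) e = u & ha s (6, 0) e = v])) //.
  by split=> [[e [? ? ? ?]]|[e [? [? ? ?]]]]; exists e; do !split.
move=> i il; have [-> -> _ -> _] := proj2 S i il; split=> [[]|[]]; last by move=> -> -> ->.
by case: (_.1.2).
Qed.

Lemma graph_rev c s u v : graph 1 0 c s u v <-> graph 0 1 c s v u.
Proof. by split=> [[e [? ? ? ?]]|[e [? ? ? ?]]]; exists e. Qed.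

Lemma edges_lt s : estored pedges s ->
  forall e, 0 < e <= hr s rM -> ha s (5, 0) e < nt * na * na /\ ha s (6, 0) e < nt * na * na.
Proof.
move=> [EM El] [//|e]; rewrite EM => el; have [-> -> _ _ _] := El e el.
by apply/pedges_lt/mem_nth.
Qed.

Local Notation N := (nt * na * na).

Definition root_cost (lt la : seq nat) :=
  size lt * (size la * (size la * 4 + 5) + 5) + 3.

Definition phase_cost r := size pedges * 17 + N * 22 + r * 11 + 5.

Definition main_cost :=
  nt * 3 + nt * na * 4 + na * 5 + size aes * 7 + 32 +
  (size tes * (size amoves * (size amoves * 9 + 4) + 9) + 3 +
  (root_cost tini aini + (phase_cost (size (proots tini aini)) +
  (root_cost tfin afin + (phase_cost (size (proots tfin afin)) +
  (N * (1 + 2) + 2 + (phase_cost N + (phase_cost N + (size pedges * 8 + 3)).+1)).+1)).+4)).+4).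

Lemma main_spec s :
  input_ok (ha s inp) -> (forall d i, d != inp -> ha s d i = 0) ->
  T mainprog s main_cost (fun s' => hr s' 0 != 0 <-> ~ bad_cycle).
Proof.
move=> I Z.
apply: T_seq; apply: setup_spec I _ => s1 F1 C1.
apply: T_seq; apply: edgeprog_spec => // s2 F2 S2.
have C2 := ctx_frame F2 erefl erefl C1.
do 4 apply: T_set_seq.
apply: T_seq; rewrite -/(root_cost _ _).
apply: (@rootprog_spec _ _ tini aini) => /=.
- by case: C2.
- by rewrite (c_it C2).
- by rewrite (c_ia C2).
- by rewrite (c_oti C2); exact: in_tini (c_inp C2).
- by rewrite (c_oai C2); exact: in_aini (c_inp C2).
- exact: ok_tini pok.
- exact: ok_aini pok.
set s2' := setr _ _ _ => s3 F3 [R3 L3].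
have C3 : ctx s3 by apply: ctx_frame F3 erefl erefl _; case: C2.
have S3 : estored pedges s3 by apply: estored_frame F3 erefl erefl _; case: S2.
apply: T_seq; rewrite /phase_cost -(proj1 S3).
apply: (phase_spec R3 L3 _ _ (edges_lt S3)).
- by move=> v; rewrite (proj2 F3) //= (proj2 F2) // (proj2 F1) // Z.
- by move=> v; rewrite (proj2 F3) //= (proj2 F2) // (proj2 F1) // Z.
- by move=> r; apply: proots_lt; [exact: ok_tini pok|exact: ok_aini pok].
move=> s4 od4 F4 D4 _ _.
have C4 := ctx_frame F4 erefl erefl C3.
have S4 := estored_frame F4 erefl erefl S3.
have {}D4 := dfs_result_ext (graph_all S3) D4.
do 4 apply: T_set_seq.
apply: T_seq; apply: (@rootprog_spec _ _ tfin afin) => /=.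
- by case: C4.
- by rewrite (c_ft C4).
- by rewrite (c_fa C4).
- by rewrite (c_otf C4); exact: in_tfin (c_inp C4).
- by rewrite (c_oaf C4); exact: in_afin (c_inp C4).
- exact: ok_tfin pok.
- exact: ok_afin pok.
set s4' := setr _ _ _ => s5 F5 [R5 L5].
have C5 : ctx s5 by apply: ctx_frame F5 erefl erefl _; case: C4.
have S5 : estored pedges s5 by apply: estored_frame F5 erefl erefl _; case: S4.
have lt10 e : 0 < e <= hr s5 rM -> ha s5 (6, 0) e < N /\ ha s5 (5, 0) e < N.
  by move=> /(edges_lt S5)[].
apply: T_seq; rewrite (proj1 S3) -(proj1 S5).
apply: (phase_spec R5 L5 _ _ lt10).
- by move=> v; rewrite (proj2 F5) //= (proj2 F4) // (proj2 F3) //= (proj2 F2) // (proj2 F1) // Z.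
- by move=> v; rewrite (proj2 F5) //= (proj2 F4) // (proj2 F3) //= (proj2 F2) // (proj2 F1) // Z.
- by move=> r; apply: proots_lt; [exact: ok_tfin pok|exact: ok_afin pok].
move=> s6 od6 F6 D6 _ _.
have C6 := ctx_frame F6 erefl erefl C5.
have S6 := estored_frame F6 erefl erefl S5.
have {}D6 : dfs_result (fun u v => gall v u) (proots tfin afin) (ha s6 (3, 2)) od6.
  apply: dfs_result_ext D6 => u v; rewrite -(graph_all S5); exact: graph_rev.
apply: T_set_seq; apply: T_seq.
apply: (@T_for (fun j s => forall i, i < j -> ha s (4, 4) i = i)) => //=; first exact: c_N C6.
  move=> j s7 F7 I7 jl Ej; apply: T_put => /= i; rewrite ltnS leq_eqVlt Ej /upd => /orP[/eqP->|il].
    by rewrite eqxx.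
  by rewrite ltn_eqF //; apply: I7.
move=> s7 F7 L7.
have C7 : ctx s7 by apply: ctx_frame F7 erefl erefl _; case: C6.
have S7 : estored pedges s7 by apply: estored_frame F7 erefl erefl _; case: S6.
have R7 : hr s7 rNR = size (iota 0 N) by rewrite (proj1 F7) //= (c_N C6) size_iota.
have {}L7 : listed (ha s7 (4, 4)) (iota 0 N).
  by move=> i; rewrite size_iota => il; rewrite nth_iota // L7.
apply: T_seq; rewrite (proj1 S5) -(proj1 S7).
have cE (r : seq nat) : size r = N -> hr s7 rM * 17 + N * 22 + N * 11 + 5 =
    hr s7 rM * 17 + N * 22 + size r * 11 + 5 by move=> ->.
rewrite {1}(cE (iota 0 N)); last by rewrite size_iota.
apply: (phase_spec R7 L7 _ _ (edges_lt S7)).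
- by move=> v; rewrite (proj2 F7) //= (proj2 F6) // (proj2 F5) //= (proj2 F4) // (proj2 F3) //=
    (proj2 F2) // (proj2 F1) // Z.
- by move=> v; rewrite (proj2 F7) //= (proj2 F6) // (proj2 F5) //= (proj2 F4) // (proj2 F3) //=
    (proj2 F2) // (proj2 F1) // Z.
- by move=> r; rewrite mem_iota.
move=> s8 od8 F8 D8 R8 L8.
have S8 : estored pedges s8 := estored_frame F8 erefl erefl S7.
have {}D8 := dfs_result_ext (graph_lam S7) D8.
(* Every vertex was a root of this search, so the finishing order lists all of them. It is thus a
   valid list of roots, of length [N], for the second pass. *)
have od_mem v : v \in od8 = (v < N).
  rewrite (dfs_order D8); apply/idP/idP => [/(dfs_marked D8)[r]|vN].
    rewrite mem_iota => rN; elim=> // x y _ _ [e /pedges_lt[_ eN] [_ <- _]] //.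
  by apply/(dfs_marked D8); exists v; [rewrite mem_iota|apply: reach_refl].
have size_od : size od8 = N.
  rewrite -(size_iota 0 N); apply/perm_size/uniq_perm; rewrite ?iota_uniq ?(dfs_uniq D8) // => v.
  by rewrite od_mem mem_iota.
apply: T_set_seq => /=; set s8' := setr _ _ _.
apply: T_seq; rewrite (cE _ size_od) (_ : hr s7 rM = hr s8' rM); last by rewrite /= (proj1 F8).
have lt10' e : 0 < e <= hr s8' rM -> ha s8' (6, 0) e < N /\ ha s8' (5, 0) e < N.
  by move=> /(edges_lt S8)[].
apply: (phase_spec _ _ _ _ lt10') => //=.
- by move=> v; rewrite (proj2 F8) //= (proj2 F7) //= (proj2 F6) // (proj2 F5) //= (proj2 F4) //
    (proj2 F3) //= (proj2 F2) // (proj2 F1) // Z.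
- by move=> v; rewrite (proj2 F8) //= (proj2 F7) //= (proj2 F6) // (proj2 F5) //= (proj2 F4) //
    (proj2 F3) //= (proj2 F2) // (proj2 F1) // Z.
- by move=> r; rewrite od_mem.
move=> s9 od9 F9 D9 _ _.
have S9 : estored pedges s9 by apply: estored_frame F9 erefl erefl _; case: S8.
have {}D9 : dfs_result (fun u v => glam v u) od8 (ha s9 (3, 5)) od9.
  apply: dfs_result_ext D9 => u v; rewrite -(graph_lam S8); exact: graph_rev.
rewrite (_ : hr s8 11 = size pedges); last exact: (proj1 S8).
apply: (check_spec S9 (F := ha s4 (3, 0)) (B := ha s6 (3, 2)) _ _ erefl) => //.
- by rewrite (proj2 F9) //= (proj2 F8) //= (proj2 F7) //= (proj2 F6) // (proj2 F5).
- by rewrite (proj2 F9) //= (proj2 F8) //= (proj2 F7).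
move=> s10 ->; rewrite eqb0 negbK; apply: (iff_trans (B := ~ (exists2 e, e \in pedges &
  [&& 1 - (e.1.2 + (1 - e.2)) != 0, ha s4 (3, 0) e.1.1.1 != 0,
      ha s6 (3, 2) e.1.1.1 != 0 & ha s9 (3, 5) e.1.1.1 == ha s9 (3, 5) e.1.1.2]))).
  by split=> [/hasPn H [e /H/negbTE->]//|H]; apply/hasPn => e ein; apply/negP => b; apply: H; exists e.
have G u v : glam u v -> u \in od8.
  by move=> [e /pedges_lt[eN _] [<- _ _]]; rewrite od_mem.
suff X e : e \in pedges -> [&& 1 - (e.1.2 + (1 - e.2)) != 0, ha s4 (3, 0) e.1.1.1 != 0,
      ha s6 (3, 2) e.1.1.1 != 0 & ha s9 (3, 5) e.1.1.1 == ha s9 (3, 5) e.1.1.2] <->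
     [/\ e.1.2 = 0, e.2 != 0,
      exists2 r, r \in proots tini aini & reach gall r e.1.1.1,
      exists2 r, r \in proots tfin afin & reach gall e.1.1.1 r
    & reach glam e.1.1.2 e.1.1.1].
  by split=> H [e ein /(X e ein) P]; apply: H; exists e.
move=> ein; have [lt1 lt2] := pedges_lt ein.
have lamE : e.1.2 = 0 -> glam e.1.1.1 e.1.1.2 by exists e.
(* The edge itself gives one direction of mutual reachability, so equality of labels amounts to a
   return path from its target to its source. *)
have K := kosaraju D8 D9 G (u := e.1.1.1) (v := e.1.1.2); rewrite !od_mem in K.
split.
  move=> /and4P[b /(dfs_marked D4) m4 /(dfs_marked D6)[r rr Rr] /eqP/K[]// _ Rk].
  by split=> //; [lia|lia|exists r => //; apply: reach_rev Rr].
move=> [e0 e1 m4 [r rr Rr] Rk]; apply/and4P; split.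
- by rewrite e0; lia.
- exact/(dfs_marked D4).
- by apply/(dfs_marked D6); exists r => //; apply: reach_rev Rr.
- by apply/eqP/K => //; split=> //; apply: reach1; apply: lamE.
Qed.

End Main.

(** * Input format and the random access machine *)

Definition encode (pb : problem) : seq nat :=
  ([:: nt pb; size (tes pb); size (tini pb); size (tfin pb)]
   ++ flatten [seq [:: e.1.1.1; e.1.1.2; e.1.2; e.2] | e <- tes pb]
   ++ tini pb ++ tfin pb)
  ++ [:: na pb; size (aes pb); size (aini pb); size (afin pb)]
   ++ flatten [seq [:: e.1.1; e.1.2; e.2] | e <- aes pb]
   ++ aini pb ++ afin pb.

Lemma size_flatten_const (X Y : Type) (F : X -> seq Y) k l :
  (forall x, size (F x) = k) -> size (flatten (map F l)) = k * size l.
Proof. by move=> H; elim: l => [|x l IH] /=; rewrite ?muln0 // size_cat H IH mulnS. Qed.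

Lemma nth_flatten_const (X Y : Type) (F : X -> seq Y) k x0 y0 l i j :
  (forall x, size (F x) = k) -> i < size l -> j < k ->
  nth y0 (flatten (map F l)) (k * i + j) = nth y0 (F (nth x0 l i)) j.
Proof.
move=> H; elim: l i => //= x l IH [|i] il jk.
  by rewrite muln0 add0n nth_cat H jk.
rewrite nth_cat H mulnS -addnA ltnNge leq_addr /= addKn; exact: IH.
Qed.

Lemma nth_cat_at (s1 s2 : seq nat) n i : size s1 = n -> nth 0 (s1 ++ s2) (n + i) = nth 0 s2 i.
Proof. by move=> <-; rewrite nth_cat ltnNge leq_addr addKn. Qed.

Lemma nth_cat_lt (s1 s2 : seq nat) i : i < size s1 -> nth 0 (s1 ++ s2) i = nth 0 s1 i.
Proof. by rewrite nth_cat => ->. Qed.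

Lemma size_encode pb : size (encode pb) = off_afin pb + size (afin pb).
Proof.
rewrite /encode /off_afin /off_aini /off_a /off_tfin /off_tini !size_cat.
rewrite (@size_flatten_const _ _ _ 4) // (@size_flatten_const _ _ _ 3) //=; lia.
Qed.

Lemma input_ok_encode pb : input_ok pb (nth 0 (encode pb)).
Proof.
rewrite /encode -!catA.
set h1 := [:: nt pb; _; _; _]; set b1 := flatten _; set h2 := [:: na pb; _; _; _]; set b2 := flatten _.
have sb1 : size b1 = 4 * size (tes pb) by rewrite (@size_flatten_const _ _ _ 4).
have sb2 : size b2 = 3 * size (aes pb) by rewrite (@size_flatten_const _ _ _ 3).
set x := h1 ++ _.
have A1 i : nth 0 x (4 + i) = nth 0 (b1 ++ tini pb ++ tfin pb ++ h2 ++ b2 ++ aini pb ++ afin pb) i.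
  exact: nth_cat_at.
have A2 i : nth 0 x (off_tini pb + i) = nth 0 (tini pb ++ tfin pb ++ h2 ++ b2 ++ aini pb ++ afin pb) i.
  by rewrite /off_tini -addnA A1 nth_cat_at.
have A3 i : nth 0 x (off_tfin pb + i) = nth 0 (tfin pb ++ h2 ++ b2 ++ aini pb ++ afin pb) i.
  by rewrite /off_tfin -addnA A2 nth_cat_at.
have A4 i : nth 0 x (off_a pb + i) = nth 0 (h2 ++ b2 ++ aini pb ++ afin pb) i.
  by rewrite /off_a -addnA A3 nth_cat_at.
have A5 i : nth 0 x (off_a pb + 4 + i) = nth 0 (b2 ++ aini pb ++ afin pb) i.
  by rewrite -addnA A4 nth_cat_at.
have A6 i : nth 0 x (off_aini pb + i) = nth 0 (aini pb ++ afin pb) i.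
  by rewrite /off_aini -addnA A5 nth_cat_at.
have A7 i : nth 0 x (off_afin pb + i) = nth 0 (afin pb) i.
  by rewrite /off_afin -addnA A6 nth_cat_at.
have N4 i j : i < size (tes pb) -> j < 4 -> nth 0 x (4 + (4 * i + j)) =
    let e := nth (0, 0, 0, 0) (tes pb) i in nth 0 [:: e.1.1.1; e.1.1.2; e.1.2; e.2] j.
  move=> il jl; rewrite A1 nth_cat_lt; last by rewrite sb1; lia.
  exact: nth_flatten_const.
have N3 i j : i < size (aes pb) -> j < 3 -> nth 0 x (off_a pb + 4 + (3 * i + j)) =
    let e := nth (0, 0, 0) (aes pb) i in nth 0 [:: e.1.1; e.1.2; e.2] j.
  move=> il jl; rewrite A5 nth_cat_lt; last by rewrite sb2; lia.
  exact: nth_flatten_const.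
split=> //.
- move=> i il /=; split.
  + by have := N4 i 0 il isT; rewrite addn0.
  + by have := N4 i 1 il isT => /= <-; congr nth; lia.
  + by have := N4 i 2 il isT => /= <-; congr nth; lia.
  + by have := N4 i 3 il isT => /= <-; congr nth; lia.
- by move=> i il; rewrite A2 nth_cat_lt.
- by move=> i il; rewrite A3 nth_cat_lt.
- by rewrite -[off_a pb]addn0 A4.
- move=> i il /=; split.
  + by have := N3 i 0 il isT; rewrite addn0.
  + by have := N3 i 1 il isT => /= <-; congr nth; lia.
  + by have := N3 i 2 il isT => /= <-; congr nth; lia.
- by move=> i il; rewrite A6 nth_cat_lt.
Qed.

(** * Copying the input into an array *)

Definition copystep : prog :=
  Seq (SetMem (addr (10, 0) (Reg 2)) (Get (Reg 2))) (SetReg 2 (Add (Reg 2) (Cst 1))).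

Definition copy : prog := While (Monus (Reg 0) (Reg 2)) copystep.

(** The base address [L] is the length of the input, so the arrays start right behind it and copying
    overwrites nothing still to be read. All other array cells remain 0, as [main_spec] demands. *)
Definition copy_inv (x : seq nat) L j (s : config) : Prop :=
  [/\ regs s 0 = L, regs s 2 = j, forall i, i < L -> cells s i = nth 0 x i &
   forall d i, wfid d -> cells s (L + offset d + 128 * i) =
     if (d == (10, 0)) && (i < j) then nth 0 x i else 0].

Lemma copy_exec x L : forall k j s, k + j = L -> copy_inv x L j s ->
  exists n s', [/\ exec copy s n s', n <= k.+1 * (pcost copy * 3) & copy_inv x L L s'].
Proof.
have P1 : (cost (Monus (Reg 0) (Reg 2))).+1 <= pcost copy by rewrite leq_maxl.
have P2 : pcost copystep <= pcost copy by rewrite leq_maxr.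
elim=> [|k IH] j s E [R0 R2 I A].
  rewrite add0n in E; rewrite E in R2 A; eexists _, s; split; [apply: exec_while_false| |exact: (And4 R0 R2 I A)].
    by rewrite /= R0 R2 subnn.
  lia.
set s1 := Config (regs s) (upd (cells s) (eval s (addr (10, 0) (Reg 2))) (eval s (Get (Reg 2)))).
set s2 := Config (upd (regs s1) 2 (eval s1 (Add (Reg 2) (Cst 1)))) (cells s1).
have I2 : copy_inv x L j.+1 s2.
  split=> //.
  - by rewrite /= /upd /= R2 addn1.
  - move=> i iL; rewrite /s2 /s1 /cells -/(cells s) eval_addr R0 /upd.
    by rewrite ifN ?I //; apply/eqP => Ei; move: iL; rewrite Ei; lia.
  - move=> d i wd; rewrite /s2 /s1 /cells -/(cells s) eval_addr R0 /upd /= R2.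
    case: eqP => [Ei|ne].
      have Ei' := addnI (etrans (addnA _ _ _) (etrans Ei (esym (addnA _ _ _)))).
      have [-> ->] := offset_inj wd (isT : wfid (10, 0)) Ei'.
      by rewrite eqxx ltnSn I //; lia.
    rewrite A //; case: eqP => //= Ed; rewrite ltnS.
    case: ltngtP => // Ei; case: ne; by rewrite Ed Ei.
have [|n [s' [X Ln Q]]] := IH j.+1 s2 _ I2; first by lia.
eexists _, s'; split; [apply: exec_while_true X| |exact: Q].
- by rewrite /= R0 R2; lia.
- by apply: exec_seq; [apply: exec_setmem|apply: exec_setreg].
have /andP[P3 P4] : (pcost (SetMem (addr (10, 0) (Reg 2)) (Get (Reg 2))) <= pcost copy) &&
  (pcost (SetReg 2 (Add (Reg 2) (Cst 1))) <= pcost copy) by rewrite -geq_max.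
apply: leq_trans (leq_add (leq_add P1 (leq_add P3 P4)) Ln) _.
by move: (pcost copy) => D'; lia.
Qed.

Definition off_a_expr : expr :=
  Add (Add (Add (Cst 4) (times 4 (Get (Cst 1)))) (Get (Cst 2))) (Get (Cst 3)).

(** The machine is not told the length of its input; it is recovered from the two headers, to serve
    as base address. *)
Definition length_expr : expr :=
  Add (Add (Add (Add (Reg 1) (Cst 4)) (times 3 (Get (Add (Reg 1) (Cst 1)))))
    (Get (Add (Reg 1) (Cst 2)))) (Get (Add (Reg 1) (Cst 3))).

Definition ram_main : prog :=
  Seq (SetReg 0 length_expr) (Seq (SetReg 2 (Cst 0)) (Seq copy
    (Seq (cprog mainprog) (SetReg 0 (Reg 1))))).

(** An automaton without states has size 0, leaving only constant time whatever the transducer. Its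
    language is empty, so it is accepted at once, before the rest of the input is touched. *)
Definition ram_prog : prog :=
  Seq (SetReg 1 off_a_expr) (If (Get (Reg 1)) ram_main (SetReg 0 (Cst 1))).

Definition pb_size pb := (nt pb + size (tes pb)) * (na pb + size (aes pb)) ^ 2.

Record pb_bounded pb : Prop := PbBounded {
  b_nt : 0 < nt pb;
  b_tini : size (tini pb) <= nt pb; b_tfin : size (tfin pb) <= nt pb;
  b_aini : size (aini pb) <= na pb; b_afin : size (afin pb) <= na pb }.

(** Every monomial of the cost, padded with factors 1, has one factor at most |t| and two at most
    |a|; 1000 exceeds the sum of the coefficients. *)
Lemma main_cost_le pb : 0 < na pb -> pb_bounded pb -> main_cost pb <= 1000 * pb_size pb.
Proof.
move=> na0 [nt0 L1 L2 L3 L4]; rewrite /main_cost /root_cost /phase_cost.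
have := size_pedges pb; have := size_proots pb (tini pb) (aini pb).
have := size_proots pb (tfin pb) (afin pb); rewrite size_amoves /pb_size expnS expn1.
move: (size (pedges pb)) (size (proots _ _ _)) (size (proots _ _ _)) => M R1 R2.
move: (size (tini pb)) (size (tfin pb)) (size (aini pb)) (size (afin pb)) L1 L2 L3 L4.
move: (nt pb) (na pb) (size (tes pb)) (size (aes pb)) nt0 na0 => t n m k t0 n0 ti tf ai af.
move=> L1 L2 L3 L4 HR2 HR1 HM.
have Ha : n <= n + k by lia.
set A := n + k in HM Ha *; set S := (t + m) * (A * A).
have A0 : 0 < A by lia.
have tS : t <= t + m by lia.
have mS : m <= t + m by lia.
have mono p q r : p <= t + m -> q <= A -> r <= A -> p * (q * r) <= S.
  by move=> *; rewrite /S !leq_mul.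
have E1 := mono t 1 1 tS A0 A0.
have E2 := mono t n 1 tS Ha A0.
have E3 := mono t n n tS Ha Ha.
have E4 := mono 1 A 1 ltac:(lia) (leqnn A) A0.
have E5 := mono m A A mS (leqnn A) (leqnn A).
have E6 := mono m A 1 mS (leqnn A) A0.
have E7 := mono m 1 1 mS A0 A0.
have E8 := mono ti ai ai ltac:(lia) ltac:(lia) ltac:(lia).
have E9 := mono tf af af ltac:(lia) ltac:(lia) ltac:(lia).
have E10 := mono ti ai 1 ltac:(lia) ltac:(lia) A0.
have E11 := mono tf af 1 ltac:(lia) ltac:(lia) A0.
have E12 := mono 1 1 1 ltac:(lia) A0 A0.
have E13 := mono ti 1 1 ltac:(lia) A0 A0.
have E14 := mono tf 1 1 ltac:(lia) A0 A0.
have kA : k <= A by lia.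
clear mono; clearbody A S.
lia.
Qed.

Lemma bad_cycle_na0 pb : prob_ok pb -> na pb = 0 -> ~ bad_cycle pb.
Proof.
move=> ok n0 [e _ [_ _ [r + _] _ _]].
move=> /flatten_mapP[p _ /flatten_mapP[q qa _]].
by have := ok_aini ok qa; rewrite n0.
Qed.

Lemma length_le pb : pb_bounded pb -> 0 < na pb -> size (encode pb) <= 30 * pb_size pb.
Proof.
move=> [nt0 L1 L2 L3 L4] na0; rewrite size_encode.
rewrite /off_afin /off_aini /off_a /off_tfin /off_tini /pb_size expnS expn1.
set A := na pb + size (aes pb); set t := nt pb + size (tes pb).
have A0 : 0 < A by rewrite /A; lia.
have t0 : 0 < t by rewrite /t; lia.
have H1 : t <= t * (A * A) by rewrite leq_pmulr // muln_gt0 A0.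
have H2 : A <= t * (A * A) by rewrite mulnA leq_pmull // muln_gt0 t0.
by move: H1 H2; move: (t * (A * A)) => S; rewrite /t /A; lia.
Qed.

(** The factor 31 covers copying an input of length at most 30 [pb_size], and 1000 comes from
    [main_cost_le]; the other terms pay for the fixed overhead. *)
Definition ram_const : nat :=
  cost off_a_expr + cost length_expr + pcost copy * 3 * 31 + pcost (cprog mainprog) * 1000 + 20.

Theorem ram_decides pb : prob_ok pb -> pb_bounded pb ->
  exists n s, [/\ exec ram_prog (init_config (encode pb)) n s,
    n <= ram_const * (pb_size pb).+1 & accepting s <-> ~ bad_cycle pb].
Proof.
move=> ok bd; set x := encode pb; have I : input_ok pb (nth 0 x) := input_ok_encode pb.
have sx : size x = off_afin pb + size (afin pb) := size_encode pb.
have Hx : 0 < na pb -> size x <= 30 * pb_size pb := length_le bd.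
clearbody x; set s0 := init_config x.
have E1 : eval s0 off_a_expr = off_a pb.
  change (4 + eval s0 (times 4 (Get (Cst 1))) + nth 0 x 2 + nth 0 x 3 = off_a pb).
  rewrite eval_times (_ : eval _ _ = nth 0 x 1) // (in_mt I) (in_it I) (in_ft I).
  by rewrite /off_a /off_tfin /off_tini.
set s1 := Config (upd (regs s0) 1 (off_a pb)) (cells s0).
have X1 : exec (SetReg 1 off_a_expr) s0 (cost off_a_expr).+1 s1.
  by rewrite /s1 -E1; apply: exec_setreg.
have Ena : eval s1 (Get (Reg 1)) = na pb by rewrite /= (in_na I).
case: (posnP (na pb)) => [n0|n0].
  eexists _, _; split.
  - apply: exec_seq X1 _; apply: exec_if_false; first by rewrite Ena.
    exact: exec_setreg.
  - rewrite /ram_const; move: (pcost copy) (pcost _) (cost length_expr) => D1 D2 D3.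
    rewrite [cost (Get _)]/= [cost (Cst _)]/=; lia.
  - by split=> // _; apply: bad_cycle_na0.
set s2 := Config (upd (regs s1) 0 (eval s1 length_expr)) (cells s1).
have EL : eval s1 length_expr = size x.
  change (off_a pb + 4 + eval s1 (times 3 (Get (Add (Reg 1) (Cst 1))))
    + nth 0 x (off_a pb + 2) + nth 0 x (off_a pb + 3) = size x).
  rewrite eval_times (_ : eval _ _ = nth 0 x (off_a pb + 1)) // (in_ma I) (in_ia I) (in_fa I) sx.
  by rewrite /off_afin /off_aini.
set s3 := Config (upd (regs s2) 2 0) (cells s2).
have I3 : copy_inv x (size x) 0 s3.
  split; [exact: EL|by []|by []|].
  move=> d i _; rewrite ltn0 andbF /= /upd /= nth_default //; lia.
have [n4 [s4 [X4 L4 [R0 R2 C4 A4]]]] := copy_exec (addn0 (size x)) I3.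
(* Some registers are already nonzero here, which is harmless: [main_spec] starts from arbitrary
   registers and constrains only the arrays. *)
pose hs := HState (fun i => regs s4 i.+1)
   (fun d i => if d == (10, 0) then nth 0 x i else 0).
have S4 : sim hs s4.
  split=> // d i wd; rewrite R0 A4 //=; case: eqP => //= _.
  by case: ltnP => // ?; rewrite nth_default.
have [|d i nd|nH [hs5 [XH LH HH]]] := @main_spec pb ok hs.
- by rewrite /=.
- by rewrite /= (negbTE nd).
have wf : wfprog mainprog by vm_compute.
have [n5 [s5 [X5 L5 [S5 _]]]] := compile_correct XH wf (leqnn _) S4.
eexists _, _; split.
- apply: exec_seq X1 _; apply: exec_if_true; first by rewrite Ena -lt0n.
  apply: exec_seq; first exact: exec_setreg.
  apply: exec_seq; first exact: exec_setreg.
  apply: exec_seq; first exact: X4.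
  by apply: exec_seq; [exact: X5|exact: exec_setreg].
- have Hc := main_cost_le n0 bd; have Hl := Hx n0.
  rewrite /ram_const.
  have {}L5 : n5 <= pcost (cprog mainprog) * (1000 * pb_size pb).
    by apply: leq_trans L5 _; rewrite leq_mul2l (leq_trans LH Hc) orbT.
  have {}L4 : n4 <= (30 * pb_size pb).+1 * (pcost copy * 3).
    by apply: leq_trans L4 _; rewrite leq_mul2r ltnS Hl orbT.
  rewrite [cost (Get _)]/= [cost (Cst _)]/= [cost (Reg _)]/=.
  move: (pcost copy) (pcost _) (cost length_expr) (cost off_a_expr) (pb_size pb) L4 L5 => D1 D2 D3 D4 S.
  lia.
- by rewrite /accepting /= /upd /= -S5.
Qed.

(** * The product graph *)

Section Product.
Variables (Sigma : finType) (t : transducer Sigma) (a : nfa Sigma).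

Definition vertex : finType := (tstate t * nstate a * nstate a)%type.

Definition mv (x : option Sigma) (q q' : nstate a) : bool :=
  if x is Some c then (q, c, q') \in ntrans a else q == q'.

Definition pstep (x y : option Sigma) (v w : vertex) : bool :=
  [&& (v.1.1, x, y, w.1.1) \in ttrans t, mv x v.1.2 w.1.2 & mv y v.2 w.2].

Definition word (x : option Sigma) : seq Sigma := if x is Some c then [:: c] else [::].

Inductive lpath (v : vertex) : seq Sigma -> seq Sigma -> vertex -> Prop :=
| lpath_nil : lpath v [::] [::] v
| lpath_cons x y w u1 u2 z : pstep x y v w -> lpath w u1 u2 z ->
    lpath v (word x ++ u1) (word y ++ u2) z.

Lemma lpath_cat v u1 u2 w : lpath v u1 u2 w -> forall u3 u4 z, lpath w u3 u4 z ->
  lpath v (u1 ++ u3) (u2 ++ u4) z.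
Proof.
elim=> // {}v x y {}w {}u1 {}u2 z S _ IH u3 u4 z' /IH P.
by rewrite -!catA; apply: lpath_cons S P.
Qed.

Definition start (v : vertex) := [&& v.1.1 \in tinit t, v.1.2 \in ninit a & v.2 \in ninit a].
Definition final (v : vertex) := [&& v.1.1 \in tfinal t, v.1.2 \in nfinal a & v.2 \in nfinal a].

Lemma pmap_cons (T T' : Type) (f : T -> option T') x s :
  pmap f (x :: s) = (if f x is Some y then [:: y] else [::]) ++ pmap f s.
Proof. by rewrite /=; case: (f x). Qed.

Lemma npath_cons_mv x q q' es r : mv x q q' -> npath q' es r ->
  exists2 es', npath q es' r & [seq e.1.2 | e <- es'] = word x ++ [seq e.1.2 | e <- es].
Proof.
case: x => [c|] /=; last by move=> /eqP->; exists es.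
by move=> m p; exists ((q, c, q') :: es) => //=; rewrite m eqxx.
Qed.

Lemma lpath_npath1 v u1 u2 w : lpath v u1 u2 w ->
  exists2 es, npath v.1.2 es w.1.2 & [seq e.1.2 | e <- es] = u1.
Proof.
elim=> [{}v|{}v x y {}w {}u1 {}u2 z /and3P[_ m _] _ [es p <-]]; first by exists [::]; rewrite /=.
exact: npath_cons_mv m p.
Qed.

Lemma lpath_npath2 v u1 u2 w : lpath v u1 u2 w ->
  exists2 es, npath v.2 es w.2 & [seq e.1.2 | e <- es] = u2.
Proof.
elim=> [{}v|{}v x y {}w {}u1 {}u2 z /and3P[_ _ m] _ [es p <-]]; first by exists [::]; rewrite /=.
exact: npath_cons_mv m p.
Qed.

Lemma lpath_tpath v u1 u2 w : lpath v u1 u2 w ->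
  exists es, [/\ tpath v.1.1 es w.1.1, u1 = pmap (fun e => e.1.1.2) es
    & u2 = pmap (fun e => e.1.2) es].
Proof.
elim=> [{}v|{}v x y {}w {}u1 {}u2 z /and3P[m _ _] _ [es [p -> ->]]]; first by exists [::]; split; rewrite /=.
by exists ((v.1.1, x, y, w.1.1) :: es); split; rewrite ?pmap_cons //= m eqxx.
Qed.

Lemma npath_uncons q es r x u : npath q es r -> [seq e.1.2 | e <- es] = word x ++ u ->
  exists q' es', [/\ mv x q q', npath q' es' r & [seq e.1.2 | e <- es'] = u].
Proof.
case: x => [c|] /= p; last by exists q, es.
case: es p => //= -[[q1 c1] q2] es /and3P[m /eqP<- p] [<- <-].
by exists q2, es.
Qed.

(** The run of the transducer drives the other two: each of its transitions consumes at most one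
    letter of each word. When it ends, both words are exhausted, so both automata have arrived. *)
Lemma tpath_lpath es p p' q es1 q' r es2 r' : tpath p es p' ->
  npath q es1 q' -> [seq e.1.2 | e <- es1] = pmap (fun e => e.1.1.2) es ->
  npath r es2 r' -> [seq e.1.2 | e <- es2] = pmap (fun e => e.1.2) es ->
  lpath (p, q, r) (pmap (fun e => e.1.1.2) es) (pmap (fun e => e.1.2) es) (p', q', r').
Proof.
elim: es p q r es1 es2 => [|[[[p1 x] y] p2] es IH] p q r es1 es2.
  move=> /eqP-> p1 /(congr1 size); rewrite size_map => /size0nil E1.
  move=> p2 /(congr1 size); rewrite size_map => /size0nil E2.
  by move: p1 p2; rewrite E1 E2 => /eqP-> /eqP->; apply: lpath_nil.
move=> /and3P[m /eqP<- P] P1; rewrite !pmap_cons.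
move=> /(npath_uncons P1)[q2 [es1' [m1 P1' E1]]] P2 /(npath_uncons P2)[r2 [es2' [m2 P2' E2]]].
apply: lpath_cons (IH _ _ _ _ _ P P1' E1 P2' E2).
by rewrite /pstep /= m m1 m2.
Qed.

Lemma outputs_lpath u v :
  language a u /\ outputs t u v /\ language a v <->
  exists s f, [/\ start s, final f & lpath s u v f].
Proof.
split=> [[[q [es1 [q' [i1 f1 P1 E1]]]] [[p [es [p' [i f P Eu Ev]]]] [r [es2 [r' [i2 f2 P2 E2]]]]]]|].
  exists (p, q, r), (p', q', r'); split; [exact/and3P|exact/and3P|].
  by rewrite Eu Ev; apply: tpath_lpath P P1 _ P2 _; [rewrite -E1|rewrite -E2].
move=> [s [f [/and3P[s1 s2 s3] /and3P[f1 f2 f3] P]]].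
have [es1 P1 E1] := lpath_npath1 P; have [es2 P2 E2] := lpath_npath2 P.
have [es [P0 Eu Ev]] := lpath_tpath P.
split; first by exists s.1.2, es1, f.1.2.
by split; [exists s.1.1, es, f.1.1|exists s.2, es2, f.2].
Qed.

Definition vall (v w : vertex) := exists x y, pstep x y v w.
Definition vlam (v w : vertex) := exists y, pstep None y v w.

Lemma reach_consl (A : Type) (G : A -> A -> Prop) u v w : G u v -> reach G v w -> reach G u w.
Proof. by move=> E; apply: reach_trans (reach1 E). Qed.

Lemma lpath_reach v u1 u2 w : lpath v u1 u2 w -> reach vall v w.
Proof.
elim=> [{}v|{}v x y {}w {}u1 {}u2 z S _ IH]; first exact: reach_refl.
by apply: reach_consl IH; exists x, y.
Qed.

Lemma lpath_reach_lam v u1 u2 w : lpath v u1 u2 w -> u1 = [::] -> reach vlam v w.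
Proof.
elim=> [{}v _|{}v [c|//] y {}w {}u1 {}u2 z S _ IH] //; first exact: reach_refl.
by move=> /= /IH; apply: reach_consl; exists y.
Qed.

Lemma reach_lpath v w : reach vall v w -> exists u1 u2, lpath v u1 u2 w.
Proof.
elim=> [|w1 z _ [u1 [u2 P]] [x [y S]]]; first by exists [::], [::]; apply: lpath_nil.
exists (u1 ++ (word x ++ [::])), (u2 ++ (word y ++ [::])).
by apply: lpath_cat P _ _ _ _; apply: lpath_cons S (lpath_nil _).
Qed.

Lemma reach_lpath_lam v w : reach vlam v w -> exists u2, lpath v [::] u2 w.
Proof.
elim=> [|w1 z _ [u2 P] [y S]]; first by exists [::]; apply: lpath_nil.
exists (u2 ++ (word y ++ [::])).
by apply: (lpath_cat P (u3 := [::])); apply: (lpath_cons S (lpath_nil _)).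
Qed.

(** * Pumping cycles with empty input *)

Definition pumpable := exists v w c, [/\ pstep None (Some c) v w,
  exists2 s, start s & reach vall s v, exists2 f, final f & reach vall v f & reach vlam w v].

(** The path from one written letter to a later one; the drop of the first component is the amount
    of input read in between. *)
Definition link (b b' : nat * vertex) := exists x c w u1 u2,
  [/\ pstep x (Some c) b.2 w, lpath w u1 u2 b'.2 & b.1 = size (word x) + size u1 + b'.1].

(* The entries of [l] are the sources of the transitions with nonempty output, *)
(* paired with the number of input symbols still to be read.                   *)
Lemma lpath_trace s u v f : lpath s u v f -> exists l : seq (nat * vertex),
  [/\ size l = size v,
      forall b, b \in l -> (exists u1 u2, lpath s u1 u2 b.2 /\ size u = size u1 + b.1)
         /\ reach vall b.2 f
    & forall l1 b l2, l = l1 ++ b :: l2 -> forall b', b' \in l2 -> link b b'].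
Proof.
elim=> [{}s|{}s x y w {}u {}v z S P [l [Sl El Ll]]].
  by exists [::]; split=> // -[].
have E b : b \in l -> (exists u1 u2, lpath s u1 u2 b.2 /\ size (word x ++ u) = size u1 + b.1)
         /\ reach vall b.2 z.
  move=> /El [[u1 [u2 [P1 E1]]] R]; split=> //.
  by exists (word x ++ u1), (word y ++ u2); split; [apply: lpath_cons S P1|rewrite !size_cat E1 addnA].
case: y S E => [c|] S E; last by exists l.
exists ((size (word x ++ u), s) :: l); split=> [|b|l1 b l2].
- by rewrite /= Sl.
- rewrite inE => /orP[/eqP->|]; last exact: E.
  split; first by exists [::], [::]; split=> //; apply: lpath_nil.
  by apply: lpath_reach (lpath_cons S P).
case: l1 => [|b1 l1] /= [].
  move=> <- <- b' /El[[u1 [u2 [P1 E1]]] _]; exists x, c, w, u1, u2; split=> //.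
  by rewrite size_cat E1 addnA.
by move=> _ /Ll.
Qed.

Lemma not_uniq_split (T : eqType) (l : seq T) : ~~ uniq l ->
  exists l1 b l2, l = l1 ++ b :: l2 /\ b \in l2.
Proof.
elim: l => //= b l IH; rewrite negb_and negbK => /orP[bl|/IH[l1 [b' [l2 [-> b'l]]]]].
  by exists [::], b, l.
by exists (b :: l1), b', l2.
Qed.

(** Pigeonhole: a letter of the output is written at one of [(size u).+1] input positions and from
    one of the vertices, so two letters agree in both. *)
Lemma long_pumpable s u v f : start s -> final f -> lpath s u v f ->
  (size u).+1 * #|vertex| < size v -> pumpable.
Proof.
move=> Hs Hf P Lv; have [l [Sl El Ll]] := lpath_trace P.
have /not_uniq_split[l1 [b [l2 [E bl2]]]] : ~~ uniq l.
  apply/negP => U; move: Lv; rewrite -Sl ltnNge => /negP; apply.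
  have -> : (size u).+1 * #|vertex| =
      size [seq (k, z) | k <- iota 0 (size u).+1, z <- enum vertex].
    by rewrite size_allpairs size_iota -cardE.
  apply: uniq_leq_size U _ => -[k z] /El[[u1 [u2 [_ E1]]] _].
  by apply: allpairs_f; [rewrite mem_iota E1 /= add0n ltnS leq_addl|rewrite mem_enum].
have [x [c [w [u1 [u2 [S1 P1 E1]]]]]] := Ll _ _ _ E _ bl2.
have bl : b \in l by rewrite E mem_cat inE eqxx orbT.
have [[u3 [u4 [P3 _]]] R] := El _ bl.
(* The same amount of input remains at both visits, so the cycle between them reads nothing. *)
have {}E1 : 0 = size (word x) + size u1 by apply: (@addIn b.1); rewrite add0n.
case: x S1 E1 => [d|] S1 //; rewrite add0n => /esym/size0nil u10.
exists b.2, w, c; split=> //; [by exists s => //; apply: lpath_reach P3|by exists f|].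
exact: lpath_reach_lam P1 u10.
Qed.

(** The cycle reads nothing, so all its repetitions share the input [u1 ++ u3], while each adds at
    least the letter c to the output. *)
Lemma pumpable_long : pumpable -> exists u, language a u /\
  forall n, exists v, [/\ outputs t u v, language a v & n <= size v].
Proof.
move=> [v [w [c [S [s Hs /reach_lpath[u1 [u2 P1]]] [f Hf /reach_lpath[u3 [u4 P3]]] Rl]]]].
have [y P2] := reach_lpath_lam Rl.
have H n : exists z, n <= size z /\ lpath v u3 z f.
  elim: n => [|n [z [Lz Pz]]]; first by exists u4.
  exists ((c :: y) ++ z); split; first by rewrite size_cat /=; lia.
  by apply: (lpath_cat (lpath_cons S P2) Pz).
have O n : exists z, [/\ outputs t (u1 ++ u3) z, language a z & n <= size z] /\ language a (u1 ++ u3).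
  have [z [Lz Pz]] := H n; exists (u2 ++ z).
  have [|La [Ot Lz']] := (outputs_lpath (u1 ++ u3) (u2 ++ z)).2.
    by exists s, f; split=> //; apply: lpath_cat P1 _ _ _ Pz.
  by split=> //; split=> //; rewrite size_cat; lia.
exists (u1 ++ u3); split; first by have [z []] := O 0.
by move=> n; have [z [? _]] := O n; exists z.
Qed.

Local Open Scope classical_set_scope.

(** Over a finite alphabet there are finitely many words of each length; [ws] lists all those of
    length at most n. *)
Lemma finite_set_size (T : finType) (A : set (seq T)) :
  finite_set A <-> exists n, forall v, A v -> size v <= n.
Proof.
split=> [/finite_seqP[s ->]|[n H]].
  exists (\max_(v <- s) size v) => v /= vs; exact: leq_bigmax_seq.
pose ws := flatten [seq [seq val w | w <- enum {: k.-tuple T}] | k <- iota 0 n.+1].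
have wsP v : size v <= n -> v \in ws.
  move=> L; apply/flatten_mapP; exists (size v); first by rewrite mem_iota.
  by apply/mapP; exists (in_tuple v) => //; rewrite mem_enum.
apply: (@sub_finite_set _ _ [set` ws]); first by move=> v /H /wsP.
by apply/finite_seqP; exists ws.
Qed.

Lemma P_fin_pumpable : P_fin t (language a) <-> ~ pumpable.
Proof.
split=> [H /pumpable_long[u [Lu Hu]]|H u Lu].
  have /finite_set_size[n Hn] := H u Lu.
  have [v [Ov Lv Sv]] := Hu n.+1.
  by have := Hn v (conj Ov Lv); lia.
apply/finite_set_size; exists ((size u).+1 * #|vertex|) => v [Ov Lv].
have [s [f [Hs Hf P]]] := (outputs_lpath u v).1 (conj Lu (conj Ov Lv)).
by case: leqP => // L; case: H; apply: long_pumpable Hs Hf P L.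
Qed.

End Product.

(** * Presentations of the product graph *)

Section Encoding.
Variables (Sigma : finType) (t : transducer Sigma) (a : nfa Sigma).
Variables (qt : seq (tstate t))
  (et : seq (tstate t * option Sigma * option Sigma * tstate t)) (it ft : seq (tstate t)).
Variables (qa : seq (nstate a)) (ea : seq (nstate a * Sigma * nstate a)) (ia fa : seq (nstate a)).
Hypotheses (qtE : perm_eq qt (enum (tstate t))) (etE : perm_eq et (enum (ttrans t)))
  (itE : perm_eq it (enum (tinit t))) (ftE : perm_eq ft (enum (tfinal t))).
Hypotheses (qaE : perm_eq qa (enum (nstate a))) (eaE : perm_eq ea (enum (ntrans a)))
  (iaE : perm_eq ia (enum (ninit a))) (faE : perm_eq fa (enum (nfinal a))).

Local Notation vertex := (vertex t a).

Definition code_problem : problem := {|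
  nt := size qt;
  tes := [seq (index e.1.1.1 qt, lab_code e.1.1.2, lab_code e.1.2, index e.2 qt) | e <- et];
  tini := [seq index q qt | q <- it];
  tfin := [seq index q qt | q <- ft];
  na := size qa;
  aes := [seq (index e.1.1 qa, sym_code e.1.2, index e.2 qa) | e <- ea];
  aini := [seq index q qa | q <- ia];
  afin := [seq index q qa | q <- fa] |}.

Local Notation pb := code_problem.

Lemma encode_code_problem : encode pb =
  ([:: size qt; size et; size it; size ft]
    ++ flatten [seq [:: index e.1.1.1 qt; lab_code e.1.1.2; lab_code e.1.2; index e.2 qt] | e <- et]
    ++ [seq index q qt | q <- it] ++ [seq index q qt | q <- ft]) ++
  ([:: size qa; size ea; size ia; size fa]
    ++ flatten [seq [:: index e.1.1 qa; sym_code e.1.2; index e.2 qa] | e <- ea]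
    ++ [seq index q qa | q <- ia] ++ [seq index q qa | q <- fa]).
Proof. by rewrite /encode /= !size_map -!map_comp. Qed.

Lemma mem_qt q : q \in qt. Proof. by rewrite (perm_mem qtE) mem_enum. Qed.
Lemma mem_qa q : q \in qa. Proof. by rewrite (perm_mem qaE) mem_enum. Qed.
Lemma mem_et e : (e \in et) = (e \in ttrans t). Proof. by rewrite (perm_mem etE) mem_enum. Qed.
Lemma mem_ea e : (e \in ea) = (e \in ntrans a). Proof. by rewrite (perm_mem eaE) mem_enum. Qed.

Lemma index_qt_lt q : index q qt < size qt.
Proof. by rewrite index_mem mem_qt. Qed.

Lemma index_qa_lt q : index q qa < size qa.
Proof. by rewrite index_mem mem_qa. Qed.

Lemma code_problem_ok : prob_ok pb.
Proof.
split=> /=.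
- by move=> _ /mapP[e _ ->] /=; rewrite !index_qt_lt.
- by move=> _ /mapP[q _ ->]; apply: index_qt_lt.
- by move=> _ /mapP[q _ ->]; apply: index_qt_lt.
- by move=> _ /mapP[e _ ->] /=; rewrite !index_qa_lt.
- by move=> _ /mapP[q _ ->]; apply: index_qa_lt.
- by move=> _ /mapP[q _ ->]; apply: index_qa_lt.
Qed.

(** The lists have no repetitions, so initial and final states are at most as many as states; an
    initial state of the transducer provides positivity. *)
Lemma code_problem_bounded : pb_bounded pb.
Proof.
have size_sub (T : finType) (A : {set T}) s q :
    perm_eq q (enum T) -> perm_eq s (enum A) -> size s <= size q.
  by move=> /perm_size-> /perm_size->; rewrite -!cardE max_card.
split; rewrite /= ?size_map; [|exact: size_sub qtE itE|exact: size_sub qtE ftE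
  |exact: size_sub qaE iaE|exact: size_sub qaE faE].
rewrite (perm_size qtE) -cardE; have /set0Pn[q _] := tinit_neq0 t.
by apply/card_gt0P; exists q.
Qed.

Lemma pb_size_code : pb_size pb = transducer_size t * nfa_size a ^ 2.
Proof.
rewrite /pb_size /= !size_map (perm_size qtE) (perm_size etE) (perm_size qaE) (perm_size eaE).
by rewrite -!cardE.
Qed.

Definition vc (v : vertex) : nat :=
  vcode pb (index v.1.1 qt) (index v.1.2 qa) (index v.2 qa).

Lemma index_inj (T : eqType) (s : seq T) x y : x \in s -> index x s = index y s -> x = y.
Proof.
move=> xs E; have ys : y \in s by rewrite -index_mem -E index_mem.
by rewrite -(nth_index x xs) E nth_index.
Qed.

Lemma vcode_inj p q r p' q' r' : q < size qa -> r < size qa -> q' < size qa -> r' < size qa ->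
  vcode pb p q r = vcode pb p' q' r' -> [/\ p = p', q = q' & r = r'].
Proof.
have divmod m x y x' y' : x < m -> x' < m -> y * m + x = y' * m + x' -> y = y' /\ x = x'.
  move=> Lx Lx' E; have m0 : 0 < m by lia.
  have := congr1 (divn^~ m) E; rewrite !divnMDl // !divn_small // !addn0 => Ey.
  by split=> //; move: E; rewrite Ey => /addnI.
move=> Lq Lr Lq' Lr' /(divmod _ _ _ _ _ Lr Lr')[/(divmod _ _ _ _ _ Lq Lq')[-> ->] ->].
by [].
Qed.

Lemma vc_inj : injective vc.
Proof.
move=> [[p q] r] [[p' q'] r'] /vcode_inj; rewrite !index_qa_lt /= => -[] // Ep Eq Er.
by rewrite (index_inj (mem_qt p) Ep) (index_inj (mem_qa q) Eq) (index_inj (mem_qa r) Er).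
Qed.

Lemma lab_code_inj : injective (@lab_code Sigma).
Proof. by case=> [c|] [d|] //= [] /ord_inj/enum_rank_inj->. Qed.

Lemma mem_amoves f : f \in amoves pb <->
  exists x q q', mv x q q' /\ f = (index q qa, lab_code x, index q' qa).
Proof.
rewrite mem_cat; split=> [/orP[/mapP[i]|/mapP[_ /mapP[e eE ->] ->]]|[[c|] [q [q' [m ->]]]]].
- rewrite mem_iota add0n /= => il ->.
  have [q0 _] : exists q0 : nstate a, true by case: (qa) il => [|q0 s] // _; exists q0.
  exists None, (nth q0 qa i), (nth q0 qa i); split; first exact: eqxx.
  by rewrite index_uniq // (perm_uniq qaE) enum_uniq.
- exists (Some e.1.2), e.1.1, e.2; split=> //=.
  by rewrite -mem_ea; case: e eE => [[]].
- apply/orP; right; apply/mapP; exists (index q qa, sym_code c, index q' qa) => //.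
  by apply/mapP; exists (q, c, q') => //; rewrite mem_ea.
- move/eqP: m => ->; apply/orP; left; apply/mapP; exists (index q' qa) => //.
  by rewrite mem_iota index_qa_lt.
Qed.

Lemma mem_pedges e : e \in pedges pb <-> exists v w x y,
  pstep x y v w /\ e = (vc v, vc w, lab_code x, lab_code y).
Proof.
split.
  move=> /flatten_mapP[_ /mapP[te teE ->] /flatten_mapP[_ /mem_amoves[x [q [q' [m ->]]]]]].
  move=> /flatten_mapP[_ /mem_amoves[y [r [r' [m' ->]]]]].
  rewrite /pedge /=; case: andP => // -[/eqP/lab_code_inj Ex /eqP/lab_code_inj Ey].
  rewrite inE => /eqP->.
  exists (te.1.1.1, q, r), (te.2, q', r'), x, y; rewrite Ex Ey; split=> //.
  rewrite /pstep /= -mem_et -Ex m -Ey m' Ex Ey.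
  by case: te teE {Ex Ey} => [[[]]] /= ? ? ? ? ->.
move=> [v [w [x [y [/and3P[m0 m1 m2] ->]]]]].
apply/flatten_mapP; exists (index v.1.1 qt, lab_code x, lab_code y, index w.1.1 qt).
  by apply/mapP; exists (v.1.1, x, y, w.1.1) => //; rewrite mem_et.
apply/flatten_mapP; exists (index v.1.2 qa, lab_code x, index w.1.2 qa).
  by apply/mem_amoves; exists x, v.1.2, w.1.2.
apply/flatten_mapP; exists (index v.2 qa, lab_code y, index w.2 qa).
  by apply/mem_amoves; exists y, v.2, w.2.
by rewrite /pedge /= !eqxx inE.
Qed.

Lemma mem_proots (lt : seq (tstate t)) (la : seq (nstate a)) r :
  r \in proots pb [seq index q qt | q <- lt] [seq index q qa | q <- la] <->
  exists v : vertex, [/\ v.1.1 \in lt, v.1.2 \in la, v.2 \in la & r = vc v].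
Proof.
split.
  move=> /flatten_mapP[_ /mapP[p pl ->] /flatten_mapP[_ /mapP[q ql ->]]].
  by move=> /flatten_mapP[_ /mapP[s sl ->]]; rewrite inE => /eqP->; exists (p, q, s).
move=> [v [v1 v2 v3 ->]].
apply/flatten_mapP; exists (index v.1.1 qt); first exact: map_f.
apply/flatten_mapP; exists (index v.1.2 qa); first exact: map_f.
apply/flatten_mapP; exists (index v.2 qa); first exact: map_f.
by rewrite inE.
Qed.

(** The edges of [G'] are exactly the images of those of [G]. A path starting at an image therefore
    stays among images, and injectivity lets consecutive lifted edges fit together. *)
Lemma reach_image (A B : Type) (f : A -> B) (G : A -> A -> Prop) (G' : B -> B -> Prop) v u :
  injective f -> (forall x y, G' x y <-> exists v w, [/\ G v w, x = f v & y = f w]) ->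
  reach G' (f v) u <-> exists2 w, u = f w & reach G v w.
Proof.
move=> fi E; split=> [|[w -> R]].
  elim=> [|x y _ [w -> R] /E[w1 [w2 [g /fi Ew ->]]]]; first by exists v => //; apply: reach_refl.
  by exists w2 => //; apply: reach_step R _; rewrite Ew.
elim: R => [|x y _ R g]; first exact: reach_refl.
by apply: reach_step R _; apply/E; exists x, y.
Qed.

Lemma gall_vall x y : gall pb x y <-> exists v w : vertex, [/\ vall v w, x = vc v & y = vc w].
Proof.
split=> [[e /mem_pedges[v [w [l1 [l2 [S ->]]]]] [<- <-]]|[v [w [[l1 [l2 S]] -> ->]]]].
  by exists v, w; split=> //; exists l1, l2.
exists (vc v, vc w, lab_code l1, lab_code l2) => //.
by apply/mem_pedges; exists v, w, l1, l2.
Qed.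

Lemma glam_vlam x y : glam pb x y <-> exists v w : vertex, [/\ vlam v w, x = vc v & y = vc w].
Proof.
split=> [[e /mem_pedges[v [w [[c|] [l2 [S ->]]]]] [<- <-]]|[v [w [[l2 S] -> ->]]]] //.
  by exists v, w; split=> //; exists l2.
exists (vc v, vc w, 0, lab_code l2) => //.
by apply/mem_pedges; exists v, w, None, l2.
Qed.

Lemma bad_cycle_pumpable : bad_cycle pb <-> pumpable t a.
Proof.
have Hit q : (q \in it) = (q \in tinit t) by rewrite (perm_mem itE) mem_enum.
have Hft q : (q \in ft) = (q \in tfinal t) by rewrite (perm_mem ftE) mem_enum.
have Hia q : (q \in ia) = (q \in ninit a) by rewrite (perm_mem iaE) mem_enum.
have Hfa q : (q \in fa) = (q \in nfinal a) by rewrite (perm_mem faE) mem_enum.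
have Rall v u := reach_image v u vc_inj gall_vall.
have Rlam v u := reach_image v u vc_inj glam_vlam.
split.
  (* The conditions on the label codes leave only the case of an empty input label and a letter as
     output label. *)
  move=> [e /mem_pedges[v [w [[c|] [[d|] [S ->]]]]] [//= _ _]].
  move=> [_ /mem_proots[s [s1 s2 s3 ->]] /Rall[v' /vc_inj Ev Rs]]; subst v'.
  move=> [_ /mem_proots[f [f1 f2 f3 ->]] /Rall[f' /vc_inj Ef Rf]].
  move=> /Rlam[v1 /vc_inj Ev Rv]; subst f' v1.
  exists v, w, d; split=> //; first by exists s => //; apply/and3P; rewrite -Hit -!Hia.
  by exists f => //; apply/and3P; rewrite -Hft -!Hfa.
move=> [v [w [d [S [s /and3P[s1 s2 s3] Rs] [f /and3P[f1 f2 f3] Rf] Rv]]]].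
exists (vc v, vc w, 0, lab_code (Some d)).
  by apply/mem_pedges; exists v, w, None, (Some d).
split=> //=.
- exists (vc s); last by apply/Rall; exists v.
  by apply/mem_proots; exists s; rewrite Hit !Hia.
- exists (vc f); last by apply/Rall; exists f.
  by apply/mem_proots; exists f; rewrite Hft !Hfa.
- by apply/Rlam; exists v.
Qed.

End Encoding.

(* [.+1] only makes a difference for an automaton without states; otherwise   *)
(* the product is positive, a transducer having at least one (initial) state. *)
Theorem theorem5 (Sigma : finType) :
  exists (c : prog) (K : nat),
    forall (t : transducer Sigma) (a : nfa Sigma) (xt xa : seq nat),
      transducer_code t xt -> nfa_code a xa ->
      exists (n : nat) (s : config),
        [/\ exec c (init_config (xt ++ xa)) n s,
            n <= K * (transducer_size t * nfa_size a ^ 2).+1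
          & accepting s <-> P_fin t (language a)].
Proof.
exists ram_prog, ram_const => t a xt xa.
move=> [qt [et [it [ft [qtE etE itE ftE ->]]]]] [qa [ea [ia [fa [qaE eaE iaE faE ->]]]]].
have [n [s [X L A]]] := ram_decides (code_problem_ok et it ft ea ia fa qtE qaE)
  (code_problem_bounded et ea qtE itE ftE qaE iaE faE).
exists n, s; rewrite -(encode_code_problem qt et it ft qa ea ia fa); split=> //.
  by rewrite -(pb_size_code it ft ia fa qtE etE qaE eaE).
rewrite A P_fin_pumpable; apply: not_iff_compat.
exact: bad_cycle_pumpable.
Qed.
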